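(* Let $l\ge 1$, and let $\partial$ be the $\mathbb{C}$-derivation of the skew field $\mathcal{K}_l$ defined through the Hamiltonian $H_0$ (see context). Put $k=\alpha_0+\cdots+\alpha_l$. Then the generators of $\mathcal{K}_l$ satisfy the following relations. (0) For $l=1$: $$\partial f_0=f_0f_2+f_2f_0+\alpha_0,\quad \partial f_1=-f_1f_2-f_2f_1+\alpha_1,\quad \partial f_2=f_1-f_0,$$ $$\partial\alpha_i=0\ (i=0,1),\quad \partial h=0.$$ (1) For $l=2n$ ($n\ge 1$) and $0\le i\le l$: $$\partial f_i=f_i\Big(\sum_{1\le r\le n}f_{i+2r-1}\Big)-\Big(\sum_{1\le r\le n}f_{i+2r}\Big)f_i+\alpha_i,\qquad \partial\alpha_i=0,\quad \partial h=0.$$ (2) For $l=2n+1$ ($n\ge 1$) and $0\le i\le l$: $$\partial f_i=f_i\Big(\sum_{1\le r\le s\le n}f_{i+2r-1}f_{i+2s}\Big)-\Big(\sum_{1\le r\le s\le n}f_{i+2r}f_{i+2s+1}\Big)f_i+\Big(\frac{k}{2}-\sum_{1\le r\le n}\alpha_{i+2r}\Big)f_i+\alpha_i\sum_{1\le r\le n}f_{i+2r},$$ $$\partial\alpha_i=0,\quad \partial h=0.$$ In (1) and (2) indices are taken in $\mathbb{Z}/(l+1)\mathbb{Z}$.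
   Context: **The skew fields $\mathcal{K}_l$.** Commutators are $[a,b]=ab-ba$. For $l=1$, $\mathcal{K}_1$ is the quotient skew field of the Ore domain over $\mathbb{C}$ with generators $f_0,f_1,f_2,\alpha_0,\alpha_1,h$ and relations $[f_1,f_0]=2hf_2$, $[f_0,f_2]=[f_2,f_1]=h$, with $\alpha_0,\alpha_1,h$ central. For $l\ge 2$, $\mathcal{K}_l$ is the quotient skew field of the Ore domain over $\mathbb{C}$ with generators $f_i,\alpha_i$ ($0\le i\le l$), $h$ and relations $[f_i,f_{i+1}]=h$, $[f_i,f_j]=0$ ($j\ne i\pm1$), with all $\alpha_i$ and $h$ central; indices are in $\Gamma:=\mathbb{Z}/(l+1)\mathbb{Z}$. **Notation for the Hamiltonian.** $\varpi_0=0$ and $\varpi_i=\sum_{r=1}^l\big(\min\{i,r\}-\frac{ir}{l+1}\big)\alpha_r$ for $1\le i\le l$ (index of $\varpi$ read in $\Gamma$). For $1\le m\le l$ let $C_{i,m}=\{i,i+1,\ldots,i+m-1\}\subset\Gamma$, $\chi(C_{i,m})=\varpi_i-\varpi_{i+1}+\cdots+(-1)^{m-1}\varpi_{i+m-1}$ and $f_{C_{i,m}}=f_if_{i+1}\cdots f_{i+m-1}$ (in this cyclic order). A proper subset $C\subset\Gamma$ is uniquely a disjoint union of maximal cyclic intervals $C_{i,m_i}$ (its connected components, of length $m_i$); put $\chi(C)=\sum_i\chi(C_{i,m_i})$ and $f_C=\prod_i f_{C_{i,m_i}}$ (the factors of different components commute). For $d\ge 1$ let $S_d$ be the set of subsets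 $K\subset\Gamma$ with $|K|=d$ such that every connected component of $\Gamma\setminus K$ has even length. **Hamiltonian $H_0$.** - $l=1$: $H_0=\frac12(f_0f_1+f_1f_0)+\alpha_1f_2$. - $l=2$: $H_0=f_0f_1f_2+hf_1+\sum_{K\in S_1}\chi(\Gamma\setminus K)f_K$. - $l=2n$, $n\ge2$: $H_0=\sum_{K\in S_3}f_K+\sum_{K\in S_1}\chi(\Gamma\setminus K)f_K$. - $l=3$: $H_0=f_0f_1f_2f_3+hf_1f_2+\sum_{K\in S_2}\chi(\Gamma\setminus K)f_K+\big(\sum_{i=1}^3(-1)^{i-1}\varpi_i\big)^2$. - $l=2n+1$, $n\ge2$: $H_0=\sum_{K\in S_4}f_K+\sum_{K\in S_2}\chi(\Gamma\setminus K)f_K+\big(\sum_{i=1}^l(-1)^{i-1}\varpi_i\big)^2$. **Derivation $\partial$.** With $k=\alpha_0+\cdots+\alpha_l$, $\partial$ is the $\mathbb{C}$-derivation of $\mathcal{K}_l$ determined by $\partial\alpha_i=\frac1h[H_0,\alpha_i]$, $\partial h=\frac1h[H_0,h]$ and - for $l=1$ or $l=2n$: $\partial f_i=\frac1h[H_0,f_i]+\delta_{i,0}k$; - for $l=2n+1$, $n\ge1$: $\partial f_i=\frac1h[H_0,f_i]-(-1)^i\frac k2f_i+\delta_{i,0}kx_0$, where $x_0=f_0+f_2+\cdots+f_{l-1}$ (a central element). *)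

(* Defs.v *)
From HB Require Import structures.
From mathcomp Require Import all_boot all_order all_algebra.
From mathcomp Require Import generic_quotient boolp reals.
From mathcomp.real_closed Require Export complex.

Set Implicit Arguments.
Unset Strict Implicit.
Unset Printing Implicit Defensive.

Import GRing.Theory.
Local Open Scope ring_scope.
Local Open Scope quotient_scope.

(* Associative unital algebras presented by generators and relations, as the
   quotient of noncommutative polynomial expressions by the least congruence
   that contains the algebra axioms and the relations. *)

Inductive pterm (F : Type) (X : Type) : Type :=
| TGen of X
| TConst of F
| TAdd of pterm F X & pterm F X
| TMul of pterm F X & pterm F X.

Arguments TGen {F X} x.
Arguments TConst {F X} c.

Declare Scope pterm_scope.
Delimit Scope pterm_scope with PT.
Bind Scope pterm_scope with pterm.
Notation "s + t" := (TAdd s t) : pterm_scope.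
Notation "s * t" := (TMul s t) : pterm_scope.
Notation "c %:PT" := (TConst c) (at level 1, format "c %:PT") : pterm_scope.

Definition tcomm (F : fieldType) (X : Type) (s t : pterm F X) : pterm F X :=
  (s * t + (- 1)%R%:PT * (t * s))%PT.

Fixpoint constant_term (F : fieldType) (X : Type) (t : pterm F X) : F :=
  match t with
  | TGen _ => 0
  | TConst c => c
  | TAdd s u => constant_term s + constant_term u
  | TMul s u => constant_term s * constant_term u
  end.

(* The field relators_aug makes the origin a one-dimensional representation;
   it is only there so that 1 <> 0 holds in the presented algebra, as required
   by the MathComp structure of algebras. *)
Record presentation (F : fieldType) : Type := Presentation {
  generators : Type;
  relators : pterm F generators -> pterm F generators -> Prop;
  relators_aug : forall s t, relators s t -> constant_term s = constant_term t
}.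

Section PresentedAlgebra.
Variables (F : fieldType) (P : presentation F).
Local Notation termP := (pterm F (generators P)).
Local Open Scope pterm_scope.

Inductive teq : termP -> termP -> Prop :=
| teq_relator s t : relators s t -> teq s t
| teq_refl s : teq s s
| teq_sym s t : teq s t -> teq t s
| teq_trans s t u : teq s t -> teq t u -> teq s u
| teq_add s s' t t' : teq s s' -> teq t t' -> teq (s + t) (s' + t')
| teq_mul s s' t t' : teq s s' -> teq t t' -> teq (s * t) (s' * t')
| teq_addA s t u : teq (s + (t + u)) ((s + t) + u)
| teq_addC s t : teq (s + t) (t + s)
| teq_add0 t : teq (0%R%:PT + t) t
| teq_mulA s t u : teq (s * (t * u)) ((s * t) * u)
| teq_mul1 t : teq (1%R%:PT * t) t
| teq_mul0 t : teq (0%R%:PT * t) 0%R%:PT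
| teq_mulDl s t u : teq ((s + t) * u) (s * u + t * u)
| teq_mulDr s t u : teq (s * (t + u)) (s * t + s * u)
| teq_constD (a b : F) : teq (a + b)%R%:PT (a%:PT + b%:PT)
| teq_constM (a b : F) : teq (a * b)%R%:PT (a%:PT * b%:PT)
| teq_constC (a : F) t : teq (a%:PT * t) (t * a%:PT).

HB.instance Definition _ := gen_eqMixin termP.
HB.instance Definition _ := gen_choiceMixin termP.

Let teqb (s t : termP) : bool := `[< teq s t >].

Lemma teqb_equiv : equiv_class_of teqb.
Proof.
split=> [s|s t|t s u].
- exact/asboolP/teq_refl.
- by apply/asboolP/asboolP; apply: teq_sym.
- by move=> /asboolP st /asboolP tu; apply/asboolP/(teq_trans st tu).
Qed.

Canonical teqb_equiv_rel := EquivRelPack teqb_equiv.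

Definition presented : Type := {eq_quot teqb_equiv_rel}.

HB.instance Definition _ := Choice.on presented.

Definition pclass (t : termP) : presented := \pi_({eq_quot teqb_equiv_rel}) t.
Definition prepr (x : presented) : termP :=
  repr (x : {eq_quot teqb_equiv_rel}).

Lemma preprK x : pclass (prepr x) = x.
Proof. exact: reprK. Qed.

Lemma pclassP s t : pclass s = pclass t <-> teq s t.
Proof.
split=> [/eqmodP /asboolP //|st].
by apply/eqmodP/asboolP.
Qed.

Lemma prepr_class t : teq (prepr (pclass t)) t.
Proof. by apply/pclassP; rewrite preprK. Qed.

Definition padd (x y : presented) := pclass (prepr x + prepr y).
Definition pmul (x y : presented) := pclass (prepr x * prepr y).
Definition pconst (c : F) : presented := pclass c%:PT.
Definition popp (x : presented) := pmul (pconst (- 1)) x.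
Definition pscale (c : F) (x : presented) := pmul (pconst c) x.

Lemma pclassD s t : pclass (s + t) = padd (pclass s) (pclass t).
Proof. by apply/pclassP/teq_sym/teq_add; apply: prepr_class. Qed.

Lemma pclassM s t : pclass (s * t) = pmul (pclass s) (pclass t).
Proof. by apply/pclassP/teq_sym/teq_mul; apply: prepr_class. Qed.

Lemma pconstD a b : pconst (a + b) = padd (pconst a) (pconst b).
Proof. by rewrite -pclassD; apply/pclassP/teq_constD. Qed.

Lemma pconstM a b : pconst (a * b) = pmul (pconst a) (pconst b).
Proof. by rewrite -pclassM; apply/pclassP/teq_constM. Qed.

Lemma pconstC a x : pmul (pconst a) x = pmul x (pconst a).
Proof.
by rewrite -(preprK x) -!pclassM; apply/pclassP/teq_constC.
Qed.

Lemma paddA : associative padd.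
Proof.
move=> x y z; rewrite -(preprK x) -(preprK y) -(preprK z) -!pclassD.
exact/pclassP/teq_addA.
Qed.

Lemma paddC : commutative padd.
Proof.
move=> x y; rewrite -(preprK x) -(preprK y) -!pclassD.
exact/pclassP/teq_addC.
Qed.

Lemma padd0 : left_id (pconst 0) padd.
Proof. by move=> x; rewrite -(preprK x) -pclassD; apply/pclassP/teq_add0. Qed.

Lemma pmulA : associative pmul.
Proof.
move=> x y z; rewrite -(preprK x) -(preprK y) -(preprK z) -!pclassM.
exact/pclassP/teq_mulA.
Qed.

Lemma pmul1 : left_id (pconst 1) pmul.
Proof. by move=> x; rewrite -(preprK x) -pclassM; apply/pclassP/teq_mul1. Qed.

Lemma pmulr1 : right_id (pconst 1) pmul.
Proof. by move=> x; rewrite -pconstC pmul1. Qed.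

Lemma pmul0 : left_zero (pconst 0) pmul.
Proof. by move=> x; rewrite -(preprK x) -pclassM; apply/pclassP/teq_mul0. Qed.

Lemma pmulr0 : right_zero (pconst 0) pmul.
Proof. by move=> x; rewrite -pconstC pmul0. Qed.

Lemma pmulDl : left_distributive pmul padd.
Proof.
move=> x y z; rewrite -(preprK x) -(preprK y) -(preprK z).
by rewrite -!(pclassD, pclassM); apply/pclassP/teq_mulDl.
Qed.

Lemma pmulDr : right_distributive pmul padd.
Proof.
move=> x y z; rewrite -(preprK x) -(preprK y) -(preprK z).
by rewrite -!(pclassD, pclassM); apply/pclassP/teq_mulDr.
Qed.

Lemma paddN : left_inverse (pconst 0) popp padd.
Proof.
move=> x; rewrite /popp -{2}(pmul1 x) -pmulDl -pconstD.
by rewrite addNr pmul0.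
Qed.

Lemma pone_neq0 : pconst 1 != pconst 0.
Proof.
have aug s t : teq s t -> constant_term s = constant_term t.
  elim=> //=.
  - by move=> {}s {}t; apply: relators_aug.
  - by move=> {}s {}t u _ -> _ ->.
  - by move=> ? ? ? ? _ -> _ ->.
  - by move=> ? ? ? ? _ -> _ ->.
  - by move=> *; rewrite addrA.
  - by move=> *; rewrite addrC.
  - by move=> *; rewrite add0r.
  - by move=> *; rewrite mulrA.
  - by move=> *; rewrite mul1r.
  - by move=> *; rewrite mul0r.
  - by move=> *; rewrite mulrDl.
  - by move=> *; rewrite mulrDr.
  - by move=> *; rewrite mulrC.
by apply/eqP => /pclassP /aug /eqP; rewrite /= oner_eq0.
Qed.

HB.instance Definition _ :=
  GRing.isZmodule.Build presented paddA paddC padd0 paddN.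

HB.instance Definition _ :=
  GRing.Zmodule_isNzRing.Build presented pmulA pmul1 pmulr1 pmulDl pmulDr
    pone_neq0.

Lemma pscaleA a b x : pscale a (pscale b x) = pscale (a * b) x.
Proof. by rewrite /pscale pmulA pconstM. Qed.

Lemma pscale1 : left_id 1%R pscale.
Proof. exact: pmul1. Qed.

Lemma pscaleDr : right_distributive pscale +%R.
Proof. by move=> a x y; apply: pmulDr. Qed.

Lemma pscaleDl x : {morph pscale^~ x : a b / (a + b)%R}.
Proof. by move=> a b; rewrite /pscale pconstD; apply: pmulDl. Qed.

HB.instance Definition _ :=
  GRing.Zmodule_isLmodule.Build F presented pscaleA pscale1 pscaleDr pscaleDl.

Lemma pscaleAl (a : F) (x y : presented) : (a *: (x * y) = (a *: x) * y)%R.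
Proof. exact: pmulA. Qed.

HB.instance Definition _ := GRing.Lmodule_isLalgebra.Build F presented pscaleAl.

Lemma pscaleAr (a : F) (x y : presented) : (a *: (x * y) = x * (a *: y))%R.
Proof.
change (pmul (pconst a) (pmul x y) = pmul x (pmul (pconst a) y)).
by rewrite !pmulA pconstC.
Qed.

HB.instance Definition _ := GRing.Lalgebra_isAlgebra.Build F presented pscaleAr.

Definition gen (x : generators P) : presented := pclass (TGen x).

End PresentedAlgebra.

Arguments gen {F P} x.

(* The skew field K, with the embedding iota, is the quotient skew field of the
   (two-sided) Ore domain A; this determines (K, iota) up to a unique
   isomorphism. *)
Definition is_quotient_skew_field (F : fieldType) (A : algType F)
    (K : unitAlgType F) (iota : {lrmorphism A -> K}) : Prop :=
  [/\ forall x : K, x != 0 -> x \is a GRing.unit,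
      injective iota,
      forall x : K, exists a b : A, b != 0 /\ x = iota a * (iota b)^-1
    & forall x : K, exists a b : A, b != 0 /\ x = (iota b)^-1 * iota a].

Definition is_derivation (F : fieldType) (K : algType F)
    (d : {linear K -> K}) : Prop :=
  forall x y : K, d (x * y) = d x * y + x * d y.

Definition commutator (K : pzRingType) (a b : K) : K := a * b - b * a.

Inductive gen1 : Type := F10 | F11 | F12 | Alpha10 | Alpha11 | Hbar1.

Inductive rel1 (F : fieldType) : pterm F gen1 -> pterm F gen1 -> Prop :=
| rel1_f1f0 : rel1 (tcomm (TGen F11) (TGen F10))
                   (2%R%:PT * (TGen Hbar1 * TGen F12))
| rel1_f0f2 : rel1 (tcomm (TGen F10) (TGen F12)) (TGen Hbar1)
| rel1_f2f1 : rel1 (tcomm (TGen F12) (TGen F11)) (TGen Hbar1)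
| rel1_alpha0 x : rel1 (tcomm (TGen Alpha10) (TGen x)) 0%R%:PT
| rel1_alpha1 x : rel1 (tcomm (TGen Alpha11) (TGen x)) 0%R%:PT
| rel1_h x : rel1 (tcomm (TGen Hbar1) (TGen x)) 0%R%:PT.

Lemma rel1_aug (F : fieldType) (s t : pterm F gen1) :
  rel1 s t -> constant_term s = constant_term t.
Proof. by case=> * /=; rewrite !(mul0r, mulr0, addr0). Qed.

Definition presentation1 (F : fieldType) := Presentation (@rel1_aug F).
Definition ore1 (F : fieldType) := presented (presentation1 F).

Definition ore1_gen (F : fieldType) (x : gen1) : ore1 F :=
  @gen F (presentation1 F) x.

Section HamiltonianOne.
Variables (F : fieldType) (K : unitAlgType F).
Variables (f0 f1 f2 alpha0 alpha1 h : K).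

Definition H0_1 : K := 2^-1 *: (f0 * f1 + f1 * f0) + alpha1 * f2.

Definition is_partial1 (d : {linear K -> K}) : Prop :=
  [/\ is_derivation d,
      [/\ d alpha0 = h^-1 * commutator H0_1 alpha0,
          d alpha1 = h^-1 * commutator H0_1 alpha1
        & d h = h^-1 * commutator H0_1 h]
    & [/\ d f0 = h^-1 * commutator H0_1 f0 + (alpha0 + alpha1),
          d f1 = h^-1 * commutator H0_1 f1
        & d f2 = h^-1 * commutator H0_1 f2]].

End HamiltonianOne.

(* In what follows l >= 2. The index set Z/(l+1)Z is 'I_l.+1, and inZp sends a natural
   number to its class. For l < 2 the relations rell and H0 are not those of K_l
   and must not be used; gen1, rel1 and H0_1 cover l = 1. *)

Inductive genl (l : nat) : Type :=
| Fl of 'I_l.+1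
| Alphal of 'I_l.+1
| Hbarl.

Arguments Hbarl {l}.

Inductive rell (F : fieldType) (l : nat) :
  pterm F (genl l) -> pterm F (genl l) -> Prop :=
| rell_succ (i : 'I_l.+1) :
    rell (tcomm (TGen (Fl i)) (TGen (Fl (inZp i.+1)))) (TGen Hbarl)
| rell_far (i j : 'I_l.+1) : j != inZp i.+1 -> i != inZp j.+1 ->
    rell (tcomm (TGen (Fl i)) (TGen (Fl j))) 0%R%:PT
| rell_alpha (i : 'I_l.+1) x : rell (tcomm (TGen (Alphal i)) (TGen x)) 0%R%:PT
| rell_h x : rell (tcomm (TGen Hbarl) (TGen x)) 0%R%:PT.

Lemma rell_aug (F : fieldType) (l : nat) (s t : pterm F (genl l)) :
  rell s t -> constant_term s = constant_term t.
Proof. by case=> * /=; rewrite !(mul0r, mulr0, addr0). Qed.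

Definition presentationl (F : fieldType) (l : nat) :=
  Presentation (@rell_aug F l).
Definition orel (F : fieldType) (l : nat) := presented (presentationl F l).

Definition orel_gen (F : fieldType) (l : nat) (x : genl l) : orel F l :=
  @gen F (presentationl F l) x.

Section CyclicIntervals.
Variable l : nat.

(* C_{i,m} *)
Definition cyclic_interval (i : 'I_l.+1) (m : nat) : {set 'I_l.+1} :=
  [set inZp (i + j) | j : 'I_m].

(* The connected components of a proper subset C, each one given by the pair
   (i, m) with 1 <= m <= l such that it is C_{i,m}. *)
Definition components (C : {set 'I_l.+1}) : {set 'I_l.+1 * 'I_l.+1} :=
  [set p : 'I_l.+1 * 'I_l.+1 | (0 < p.2)%N &
    maxset (fun B : {set 'I_l.+1} =>
              (B \subset C) &&
              [exists q : 'I_l.+1 * 'I_l.+1,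
                 (0 < q.2)%N && (B == cyclic_interval q.1 q.2)])
           (cyclic_interval p.1 p.2)].

(* S_d *)
Definition even_gap_sets (d : nat) : {set {set 'I_l.+1}} :=
  [set K : {set 'I_l.+1} | (#|K| == d) &&
    [forall p in components (~: K), ~~ odd p.2]].

End CyclicIntervals.

Section Hamiltonian.
Variables (F : fieldType) (K : unitAlgType F) (l : nat).
Variables (f alpha : 'I_l.+1 -> K) (h : K).

Definition varpi (i : 'I_l.+1) : K :=
  if i == 0%N :> nat then 0 else
  \sum_(1 <= r < l.+1)
    ((minn i r)%:R - (i * r)%:R / l.+1%:R : F) *: alpha (inZp r).

Definition chi_interval (i : 'I_l.+1) (m : nat) : K :=
  \sum_(0 <= j < m) (- 1) ^+ j * varpi (inZp (i + j)).

Definition f_interval (i : 'I_l.+1) (m : nat) : K :=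
  \prod_(0 <= j < m) f (inZp (i + j)).

Definition chi (C : {set 'I_l.+1}) : K :=
  \sum_(p in components C) chi_interval p.1 p.2.

(* The factors of different components commute when f satisfies the relations
   rell, so the order of the outer product is irrelevant. *)
Definition f_set (C : {set 'I_l.+1}) : K :=
  \prod_(p in components C) f_interval p.1 p.2.

Let f_ (i : nat) : K := f (inZp i).

Definition H0_quadratic (d : nat) : K :=
  \sum_(A in even_gap_sets l d) chi (~: A) * f_set A.

Definition H0_square : K :=
  (\sum_(1 <= i < l.+1) (- 1) ^+ i.-1 * varpi (inZp i)) ^+ 2.

Definition H0 : K :=
  if l == 2%N then f_ 0 * f_ 1 * f_ 2 + h * f_ 1 + H0_quadratic 1
  else if l == 3%N then
    f_ 0 * f_ 1 * f_ 2 * f_ 3 + h * f_ 1 * f_ 2 + H0_quadratic 2 + H0_square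
  else if ~~ odd l then
    \sum_(A in even_gap_sets l 3) f_set A + H0_quadratic 1
  else \sum_(A in even_gap_sets l 4) f_set A + H0_quadratic 2 + H0_square.

Definition k_sum : K := \sum_(i < l.+1) alpha i.

Definition x0_sum : K := \sum_(i < l.+1 | ~~ odd i) f i.

Definition is_partial (d : {linear K -> K}) : Prop :=
  [/\ is_derivation d,
      forall i, d (alpha i) = h^-1 * commutator H0 (alpha i),
      d h = h^-1 * commutator H0 h
    & forall i : 'I_l.+1,
        d (f i) = h^-1 * commutator H0 (f i) +
          (if ~~ odd l then (i == 0%N :> nat)%:R * k_sum
           else - ((- 1) ^+ i * (2^-1 *: k_sum) * f i)
                + (i == 0%N :> nat)%:R * (k_sum * x0_sum))].

End Hamiltonian.

(* Main.v *)
Require Import Defs.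
From HB Require Import structures.
From mathcomp Require Import all_boot all_order all_algebra.
From mathcomp Require Import boolp reals zify ring.

(** The commutator with f_i is a derivation, and the defining relations say
    that it sends f_(i-1) to h, f_(i+1) to -h and every other generator to 0.
    Hence h^-1 [f_K, f_i] is the product over K minus i-1, when i-1 lies in K,
    minus the product over K minus i+1, when i+1 lies in K
    (commutator_f_set). Everything rests on summing these differences over
    the sets K that occur in the Hamiltonian.

    A set with even gaps that contains an index y is the same thing as a
    word y + p_1, ..., y + p_m for which all successive differences of
    0 < p_1 < ... < p_m < l+1 are odd (sum_even_gap_sets). The leading part of
    the Hamiltonian therefore contributes two sums over words of one and the
    same kind: one over the window from i-1 to i-1+(l+1), and one over the
    window that is shifted by 2. A word that avoids i lies in both windows and
    cancels. What survives are the words of the first window that begin with i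
    and the words of the second window that end with i, and these give the two
    products that appear in the formula for the derivative of f_i
    (word_sum_telescope).

    In the quadratic part each product carries as weight an alternating sum of
    the varpi_j over the gaps. Moving a point of K from i-1 to i+1 changes that
    weight by the second difference 2 varpi_i - varpi_(i-1) - varpi_(i+1).
    Since varpi is made of the fundamental weights of type A, the Cartan matrix
    turns them into simple roots: the second difference at i is alpha_i, except
    at i = 0, where it is alpha_0 - k (second_differenceE). The terms with k
    that are added to h^-1 [H0, f_i] compensate for this exception.

    For l = 2 and l = 3 the leading monomial runs once around the whole cycle,
    so the factors have no canonical order. The correction terms h f_1 and
    h f_1 f_2 make the leading part invariant under rotation
    (triangle_invariant, square_invariant), so that it may be written with f_i
    as its first factor, where the commutator is immediate.

    Two points need care. The products f_K are defined by some enumeration of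
    the components of K; their value depends only on the fact that f_x comes
    before f_(x+1) whenever both occur (prod_well_ordered). And h must be
    invertible, that is, nonzero in the presented algebra: this is read off
    from a representation by Heisenberg matrices (hbar1_neq0, hbarl_neq0). *)

Set Implicit Arguments.
Unset Strict Implicit.
Unset Printing Implicit Defensive.

Import GRing.Theory.
Local Open Scope ring_scope.

(** * Shifts of the cyclic index set *)

Section Shift.
Variable l : nat.
Implicit Types (x y : 'I_l.+1) (p q : nat).

(** The index y + p of the cyclic group; p ranges over all natural numbers, so
    that y - 1 is [shift y l]. *)
Definition shift y p : 'I_l.+1 := inZp (y + p).

Lemma shift0 y : shift y 0 = y.
Proof. by apply: val_inj; rewrite /= addn0 modn_small. Qed.

Lemma shiftS y : inZp y.+1 = shift y 1.
Proof. by rewrite /shift addn1. Qed.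

Lemma shiftD y p q : shift (shift y p) q = shift y (p + q).
Proof. by apply: val_inj; rewrite /= modnDml addnA. Qed.

Lemma shift_period y p : shift y (p + l.+1) = shift y p.
Proof. by apply: val_inj; rewrite /= addnA modnDr. Qed.

Lemma shift_full y : shift y l.+1 = y.
Proof. by rewrite -{2}[y]shift0 -(shift_period y 0). Qed.

Lemma shift_eq y p q : (shift y p == shift y q) = (p == q %[mod l.+1]).
Proof. by rewrite -val_eqE /= eqn_modDl. Qed.

Lemma shift_inj y p q : (p < l.+1)%N -> (q < l.+1)%N ->
  shift y p = shift y q -> p = q.
Proof. by move=> pl ql /eqP; rewrite shift_eq !modn_small// => /eqP. Qed.

Lemma shift_neq y p q : (p < l.+1)%N -> (q < l.+1)%N ->
  (shift y p == shift y q) = (p == q).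
Proof. by move=> pl ql; rewrite shift_eq !modn_small. Qed.

Lemma shift_surj y x : exists2 p, (p < l.+1)%N & x = shift y p.
Proof.
exists ((x + (l.+1 - y)) %% l.+1)%N; first by rewrite ltn_mod.
apply: val_inj; rewrite /= modnDmr addnCA subnKC 1?ltnW ?ltn_ord//.
by rewrite modnDr modn_small.
Qed.

Lemma shiftK y : shift (shift y l) 1 = y.
Proof. by rewrite shiftD addn1 shift_full. Qed.

End Shift.

(** * Presented algebras and the nonvanishing of h *)

Section Evaluation.
Variables (F : fieldType) (P : presentation F) (A : algType F).
Variable v : generators P -> A.

Fixpoint peval (t : pterm F (generators P)) : A :=
  match t with
  | TGen x => v x
  | TConst c => c%:A
  | TAdd s u => peval s + peval u
  | TMul s u => peval s * peval u
  end.

Lemma peval_teq : (forall s t, relators s t -> peval s = peval t) ->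
  forall s t, teq s t -> peval s = peval t.
Proof.
move=> vP s t; elim=> {s t} //=.
- by move=> s t u _ -> _ ->.
- by move=> ? ? ? ? _ -> _ ->.
- by move=> ? ? ? ? _ -> _ ->.
- by move=> *; rewrite addrA.
- by move=> *; rewrite addrC.
- by move=> *; rewrite scale0r add0r.
- by move=> *; rewrite mulrA.
- by move=> *; rewrite scale1r mul1r.
- by move=> *; rewrite scale0r mul0r.
- by move=> *; rewrite mulrDl.
- by move=> *; rewrite mulrDr.
- by move=> *; rewrite scalerDl.
- by move=> *; rewrite -scalerAl mul1r scalerA.
- by move=> *; rewrite mulr_algl mulr_algr.
Qed.

(** Nonvanishing in an algebra given by generators and relations is detected in
    any algebra in which the relations hold. *)
Lemma gen_neq0 x : (forall s t, relators s t -> peval s = peval t) ->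
  v x != 0 -> gen x != 0 :> presented P.
Proof.
move=> vP; apply: contraNneq => /pclassP /(peval_teq vP) /= ->.
by rewrite scale0r.
Qed.

Lemma peval_tcomm s t : peval (tcomm s t) = commutator (peval s) (peval t).
Proof. by rewrite /= scaleN1r mulN1r. Qed.

End Evaluation.

Lemma pclass_tcomm (F : fieldType) (P : presentation F)
    (s t : pterm F (generators P)) :
  pclass (tcomm s t) = commutator (pclass s : presented P) (pclass t).
Proof. by rewrite /tcomm pclassD !pclassM. Qed.

Lemma gen_commutator (F : fieldType) (P : presentation F)
    (K : algType F) (iota : {lrmorphism presented P -> K})
    (x y : generators P) (t : pterm F (generators P)) :
  relators (tcomm (TGen x) (TGen y)) t ->
  commutator (iota (gen x)) (iota (gen y)) = iota (pclass t).
Proof.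
move=> /teq_relator /pclassP; rewrite pclass_tcomm => <-.
by rewrite /commutator rmorphB !rmorphM.
Qed.

Lemma gen_comm (F : fieldType) (P : presentation F)
    (K : algType F) (iota : {lrmorphism presented P -> K}) (x y : generators P) :
  relators (tcomm (TGen x) (TGen y)) 0%:PT ->
  commutator (iota (gen x)) (iota (gen y)) = 0.
Proof. by move=> /gen_commutator ->; apply: rmorph0. Qed.

(** In strictly upper triangular matrices of size 3, with f_1 = - f_0, the
    Heisenberg relation holds and both sides of [f_1, f_0] = 2 h f_2 vanish. *)
Lemma hbar1_neq0 (F : fieldType) : ore1_gen F Hbar1 != 0.
Proof.
pose o := Ordinal (isT : (1 < 3)%N).
pose v (x : gen1) : 'M[F]_3 :=
  match x with
  | F10 => delta_mx ord0 o
  | F11 => - delta_mx ord0 o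
  | F12 => delta_mx o ord_max
  | Hbar1 => delta_mx ord0 ord_max
  | _ => 0
  end.
apply: (@gen_neq0 F (presentation1 F) _ v).
  have mE a b c d : (delta_mx a b * delta_mx c d : 'M[F]_3) =
      delta_mx a d *+ (b == c) by rewrite -mulmxE mul_delta_mx_cond.
  move=> s t /=; case=> [|||x|x|x]; rewrite peval_tcomm /commutator /=.
  - by rewrite mulNr mulrN !mE /= mulr0n mulr0 subrr.
  - by rewrite !mE /= subr0 .
  - by rewrite mulNr mulrN !mE /= opprK mulr0n oppr0 add0r.
  - by rewrite scale0r mul0r mulr0 subr0.
  - by rewrite scale0r mul0r mulr0 subr0.
  - by case: x; rewrite scale0r /= ?(mulNr, mulrN, mE, mulr0, mul0r, subr0) /=
      ?mulr0n ?oppr0 ?subr0 ?addr0.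
by apply/eqP => /matrixP /(_ ord0 ord_max) /eqP; rewrite !mxE /= oner_eq0.
Qed.

(** Heisenberg matrices: writing f_i as a row part plus a column part gives
    f_i f_j = c_ij h with an arbitrary matrix c of scalars, and the relations
    only prescribe c_ij - c_ji. The choice made here is c_ij = 1 for j = i + 1
    and 0 otherwise. *)
Lemma hbarl_neq0 (F : fieldType) (l : nat) : (2 <= l)%N ->
  orel_gen F (@Hbarl l) != 0.
Proof.
move=> l2; pose mid (i : 'I_l.+1) : 'I_l.+3 := inord i.+1.
have midE (i : 'I_l.+1) : mid i = i.+1 :> nat.
  by rewrite inordK // !ltnS ltnW // ltn_ord.
have mid0 i : (mid i == ord0) = false by rewrite -val_eqE /= midE.
have midm i : (mid i == ord_max) = false.
  by rewrite -val_eqE /= midE eqSS ltn_eqF ?ltn_ord.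
have mid_eq i j : (mid i == mid j) = (i == j) by rewrite -!val_eqE /= !midE.
pose v (x : genl l) : 'M[F]_l.+3 :=
  match x with
  | Fl i => delta_mx ord0 (mid i) + delta_mx (mid (shift i l)) ord_max
  | Alphal _ => 0
  | Hbarl => delta_mx ord0 ord_max
  end.
apply: (@gen_neq0 F (presentationl F l) _ v); last first.
  by apply/eqP => /matrixP /(_ ord0 ord_max) /eqP; rewrite !mxE !eqxx oner_eq0.
have mE a b c d : (delta_mx a b * delta_mx c d : 'M[F]_l.+3) =
    delta_mx a d *+ (b == c) by rewrite -mulmxE mul_delta_mx_cond.
have vM i j : v (Fl i) * v (Fl j) =
    delta_mx ord0 ord_max *+ (j == inZp i.+1).
  rewrite /v mulrDl !mulrDr !mE mid0 [ord_max == mid _]eq_sym midm mid_eq /=.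
  rewrite mulr0n !addr0 !add0r; congr (_ *+ nat_of_bool _).
  apply/eqP/eqP => [->|->]; first by rewrite shiftS shiftK.
  by rewrite shiftS shiftD add1n shift_full.
move=> s t /=; case=> [i|i j ij ji|i x|x]; rewrite peval_tcomm /commutator /=.
- rewrite -/(v (Fl i)) -/(v (Fl (inZp i.+1))) !vM eqxx.
  case: eqP => [|_]; last by rewrite subr0.
  move/eqP; rewrite !shiftS shiftD -[X in X == _]shift0.
  by rewrite shift_neq.
- by rewrite -/(v (Fl i)) -/(v (Fl j)) !vM (negbTE ij) (negbTE ji) subr0 scale0r.
- by rewrite scale0r mul0r mulr0 subr0.
- case: x => [i|i|]; rewrite scale0r /= ?(mulr0, mul0r, subr0)//.
    rewrite mulrDl mulrDr !mE [ord_max == mid _]eq_sym midm mid0.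
    by rewrite /= addr0 subr0.
  by rewrite mE subr0 mulr0n.
Qed.

(** * Connected components of a set of indices *)

Section Components.
Variable l : nat.
Implicit Types (x y : 'I_l.+1) (C : {set 'I_l.+1}) (p q : 'I_l.+1 * 'I_l.+1).

Lemma shift_pred x (p : nat) : (0 < p)%N -> shift (shift x p) l = shift x p.-1.
Proof. by case: p => // p _; rewrite shiftD addSnnS shift_period. Qed.

Lemma shift_cancel x y (p d : nat) : shift x p = shift y (d + p) -> x = shift y d.
Proof.
move=> /(congr1 val) /= /eqP; rewrite addnA eqn_modDr => /eqP xE.
by apply: val_inj; rewrite /= -xE modn_small.
Qed.

Lemma intervalP i m x :
  reflect (exists2 j, (j < m)%N & x = shift i j) (x \in cyclic_interval i m).
Proof.
apply: (iffP imsetP) => [[j _ ->]|[j jm ->]]; first by exists j.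
by exists (Ordinal jm).
Qed.

(** A component is a run of C that can be extended on neither side. This fails
    when C is everything: lengths stop at l, so every interval of length l is
    then maximal although it could be prolonged. *)
Lemma componentsP C p : C != setT ->
  reflect [/\ (0 < p.2)%N, forall j, (j < p.2)%N -> shift p.1 j \in C,
              shift p.1 l \notin C & shift p.1 p.2 \notin C]
          (p \in components C).
Proof.
case: p => i m CT; rewrite inE /=.
have ml : (m <= l)%N by rewrite -ltnS.
have interval_sub (k k' : 'I_l.+1) : reflect
    (forall j, (j < k')%N -> shift k j \in C) (cyclic_interval k k' \subset C).
  apply: (iffP subsetP) => [kC j jk|kC _ /intervalP[j jk ->]]; last exact: kC.
  by apply: kC; apply/intervalP; exists j.
apply: (iffP andP) => [[m0 /maxsetP[/andP[/interval_sub mC _] max_m]]|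
    [m0 mC predC succC]].
  have max_run (k k' : 'I_l.+1) : (0 < k')%N ->
      (forall j, (j < k')%N -> shift k j \in C) ->
      cyclic_interval i m \subset cyclic_interval k k' ->
      cyclic_interval k k' = cyclic_interval i m.
    move=> k0 kC sub; apply: max_m => //; apply/andP; split.
      exact/interval_sub.
    by apply/existsP; exists (k, k'); rewrite k0 eqxx.
  have full : m = l :> nat -> shift i l \notin C.
    move=> mE; apply: contra CT => iC; rewrite -subTset; apply/subsetP => x _.
    have [j] := shift_surj i x; rewrite ltnS leq_eqVlt => /orP[/eqP->|jl] -> //.
    by apply: mC; rewrite mE.
  split=> //.
    move: ml; rewrite leq_eqVlt => /orP[/eqP /full //|ml].
    apply/negP => iC.
    have := max_run (shift i l) (inord m.+1); rewrite inordK // => max_i.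
    have iS j : shift (shift i l) j.+1 = shift i j.
      by rewrite -(shiftD _ 1 j) shiftK.
    have E : cyclic_interval (shift i l) m.+1 = cyclic_interval i m.
      apply: max_i => // [[|j]|].
    + by rewrite shift0.
    + by rewrite ltnS iS; apply: mC.
    + apply/subsetP => _ /intervalP[j jm ->]; apply/intervalP; exists j.+1 => //.
    have : shift i l \in cyclic_interval (shift i l) m.+1.
      by apply/intervalP; exists 0%N; rewrite ?shift0.
    rewrite E => /intervalP[j jm] /shift_inj lj.
    have := lj (ltnSn l); lia.
  move: ml; rewrite leq_eqVlt => /orP[/eqP mE|ml].
    by have := full mE; rewrite mE.
  apply/negP => iC.
  have := max_run i (inord m.+1); rewrite inordK // => max_i.
  have E : cyclic_interval i m.+1 = cyclic_interval i m.
    apply: max_i => // [j|].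
  + by rewrite ltnS leq_eqVlt => /orP[/eqP->|/mC].
  + apply/subsetP => _ /intervalP[j jm ->]; apply/intervalP; exists j => //.
    exact: ltnW.
  have : shift i m \in cyclic_interval i m.+1.
    by apply/intervalP; exists m.
  rewrite E => /intervalP[j jm] /shift_inj mj.
  have := mj (ltn_ord m); lia.
split=> //; apply/maxsetP; split.
  apply/andP; split; first exact/interval_sub.
  by apply/existsP; exists (i, m); rewrite m0 eqxx.
move=> B /andP[+ /existsP[[k k'] /andP[/= k0 /eqP BE]]].
rewrite BE => /interval_sub kC sub.
have /(subsetP sub) : i \in cyclic_interval i m.
  by apply/intervalP; exists 0%N; rewrite ?shift0.
move=> /intervalP[[_|t tk] iE]; last first.
  by case/negP: predC; rewrite iE shift_pred //= kC // ltnW.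
have {}iE : k = i by rewrite iE shift0.
apply/eqP; rewrite eqEsubset sub andbT; apply/subsetP => x /intervalP[j jk ->].
apply/intervalP; exists j; last by rewrite iE.
rewrite ltnNge; apply: contra succC => mj; rewrite -iE.
by apply: kC; apply: leq_ltn_trans mj jk.
Qed.

(** Two runs that meet have the same first index, since otherwise one of them
    could be extended backwards, and then the same length. *)
Lemma component_eq C p q (j j' : nat) : C != setT ->
  p \in components C -> q \in components C -> (j < p.2)%N -> (j' < q.2)%N ->
  shift p.1 j = shift q.1 j' -> p = q.
Proof.
move=> CT; wlog jj' : p q j j' / (j <= j')%N.
  move=> IH pC qC jp jq E; case: (leqP j j') => jj'; first exact: (IH p q j j').
  by symmetry; apply: (IH q p j' j) => //; apply: ltnW.
move=> /(componentsP _ CT)[p0 pC pp ps] /(componentsP _ CT)[q0 qC qp qs] jp jq.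
rewrite -(subnK jj') => /shift_cancel.
case jE : (j' - j)%N => [|t] E; last first.
  by case/negP: pp; rewrite E shift_pred //= qC //; lia.
rewrite shift0 in E.
have m_eq : p.2 = q.2.
  apply: val_inj; apply/eqP; rewrite eqn_leq; apply/andP; split; rewrite leqNgt.
    by apply: contra qs => /pC; rewrite E.
  by apply: contra ps => /qC; rewrite E.
by rewrite [p]surjective_pairing [q]surjective_pairing E m_eq.
Qed.

Lemma component_cover C x : C != setT -> x \in C ->
  exists2 p, p \in components C & exists2 j, (j < p.2)%N & x = shift p.1 j.
Proof.
move=> CT xC.
have [y yC] : exists y, y \notin C.
  apply/existsP; rewrite -negb_forall; apply: contra CT => /forallP CT.
  by apply/eqP/setP => z; rewrite inE CT.
(* Scanning from an index y outside C, let b be the last position outside C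
   before x and c the first one after x. *)
have [q ql xE] := shift_surj y x.
have q0 : (0 < q)%N by case: q xE {ql} => // xE; rewrite xE shift0 (negbTE yC) in xC.
have exb : exists b, (b <= q)%N && (shift y b \notin C).
  by exists 0%N; rewrite shift0.
have ubb b : (b <= q)%N && (shift y b \notin C) -> (b <= q)%N by case/andP.
case: (ex_maxnP exb ubb) => b /andP[bq bC] max_b.
have exc : exists c, (q <= c)%N && (shift y c \notin C).
  by exists l.+1; rewrite shift_full yC ltnW.
case: (ex_minnP exc) => c /andP[qc cC] min_c.
have {}bq : (b < q)%N.
  by rewrite ltn_neqAle bq andbT; apply: contraNneq bC => ->; rewrite -xE.
have {}qc : (q < c)%N.
  by rewrite ltn_neqAle qc andbT; apply: contraNneq cC => <-; rewrite -xE.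
have cl : (c <= l.+1)%N by apply: min_c; rewrite shift_full yC ltnW.
have mE : (inord (c - b.+1) : 'I_l.+1) = (c - b.+1)%N :> nat by rewrite inordK //; lia.
exists (shift y b.+1, inord (c - b.+1) : 'I_l.+1); last first.
  exists (q - b.+1)%N => /=; first by rewrite mE; lia.
  by rewrite shiftD subnKC.
apply/componentsP; rewrite //= mE; split.
- lia.
- move=> j jm; rewrite shiftD; apply: contraT => jC.
  case: (leqP (b.+1 + j) q) => jq.
    by have := max_b (b.+1 + j)%N; rewrite jq jC => /(_ isT); lia.
  by have := min_c (b.+1 + j)%N; rewrite (ltnW jq) jC => /(_ isT); lia.
- by rewrite shift_pred.
- by rewrite shiftD subnKC //; lia.
Qed.

(** A word is well ordered when it has no repetition and never places an index
    after its successor: these are the linear extensions of the relation that x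
    precedes x + 1. *)
Definition well_ordered (t : seq 'I_l.+1) : bool :=
  pairwise [rel a b | (a != b) && (a != shift b 1)] t.

Definition component_word C : seq 'I_l.+1 :=
  flatten [seq [seq shift p.1 j | j <- index_iota 0 p.2]
             | p <- index_enum _ & p \in components C].

Lemma mem_component_word C x : C != setT ->
  (x \in component_word C) = (x \in C).
Proof.
move=> CT; apply/flatten_mapP/idP => [[p]|xC].
  rewrite mem_filter => /andP[/(componentsP _ CT)[_ pC _ _] _].
  by move=> /mapP[j]; rewrite mem_index_iota => /= jp ->; apply: pC.
have [p pC [j jp xE]] := component_cover CT xC.
exists p; first by rewrite mem_filter pC mem_index_enum.
by apply/mapP; exists j; rewrite ?mem_index_iota.
Qed.

Lemma pairwise_flatten (T : Type) (r : rel T) (ss : seq (seq T)) :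
  pairwise (allrel r) ss -> all (pairwise r) ss -> pairwise r (flatten ss).
Proof.
elim: ss => //= s ss IH /andP[s_ss pss] /andP[ps allp].
rewrite pairwise_cat ps IH // andbT /=.
by elim: ss s_ss {IH pss allp} => /= [|t ss IH /andP[st /IH]];
  rewrite ?allrel0r // allrel_catr st.
Qed.

Lemma well_ordered_sorted y (s : seq nat) :
  path ltn 0 s -> all (gtn l.+1) s -> well_ordered [seq shift y j | j <- s].
Proof.
move=> s_inc sl; rewrite /well_ordered pairwise_map.
move: (s_inc); rewrite (path_sortedE ltn_trans) => /andP[s0 /=].
rewrite (sorted_pairwise ltn_trans).
have sP : all [pred j | (0 < j < l.+1)%N] s by rewrite all_predI s0.
apply: sub_in_pairwise sP => a b /= /andP[a0 al] /andP[b0 bl] ab.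
rewrite shiftD shift_neq // ltn_eqF //=.
move: bl; rewrite leq_eqVlt => /orP[/eqP bl|bl].
  by rewrite addn1 bl shift_full -[X in _ != X]shift0 shift_neq // -lt0n.
by rewrite shift_neq; lia.
Qed.

Lemma well_ordered_run x m : (m <= l)%N ->
  well_ordered [seq shift x j | j <- index_iota 0 m].
Proof.
move=> ml; rewrite /well_ordered pairwise_map.
have sP : all (gtn m) (index_iota 0 m).
  by apply/allP => j; rewrite mem_index_iota.
have : pairwise ltn (index_iota 0 m).
  by rewrite -(sorted_pairwise ltn_trans) iota_ltn_sorted.
apply: sub_in_pairwise sP => a b; rewrite -!topredE /= => am bm ab.
by rewrite shiftD !shift_neq; lia.
Qed.

(** An index of one component is never the successor of an index of another one:
    either it is interior to its run, and its predecessor lies in the same run,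
    or it starts its run, and its predecessor is outside C. *)
Lemma well_ordered_component_word C : C != setT ->
  well_ordered (component_word C).
Proof.
move=> CT; apply: pairwise_flatten.
  rewrite pairwise_map.
  have comp : all (mem (components C)) [seq p <- index_enum _ | p \in components C].
    exact: filter_all.
  have := filter_uniq (mem (components C)) (index_enum_uniq _).
  rewrite uniq_pairwise; apply: sub_in_pairwise comp => p q /= pC qC pq.
  apply/allrelP => _ _ /mapP[j jp ->] /mapP[j' jq ->] /=.
  move: jp jq; rewrite !mem_index_iota /= => jp jq; apply/andP; split.
    apply: contra pq => /eqP E; apply/eqP; exact: (component_eq CT pC qC jp jq E).
  apply/negP; rewrite shiftD addn1 => /eqP E.
  have [q0 qC' qp qs] := componentsP _ CT qC.
  have [p0 pC' pp ps] := componentsP _ CT pC.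
  case: j jp E => [|j] jp E.
    by case/negP: pp; rewrite -[p.1]shift0 E shift_pred //= qC'.
  case/eqP: pq; apply: (component_eq CT pC qC (ltnW jp) jq).
  by rewrite -[j]/j.+1.-1 -shift_pred // E shift_pred.
by rewrite all_map; apply/allP => p _; apply: well_ordered_run; rewrite -ltnS.
Qed.

End Components.

(** * Sets with even gaps as words *)

Definition even_gap : rel nat := [rel u v | (u < v)%N && odd (v - u)].

(** The words of m letters strictly between the sentinels u and v, all of whose
    successive differences, including those with u and v, are odd. The next
    letter u + 2r + 1 is below v exactly when r < (v - u)./2. *)
Fixpoint even_gap_words (m u v : nat) : seq (seq nat) :=
  if m is m'.+1 then
    [seq (u + r.*2.+1)%N :: s | r <- index_iota 0 (v - u)./2,
                                s <- even_gap_words m' (u + r.*2.+1) v]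
  else if even_gap u v then [:: [::]] else [::].

Lemma mem_even_gap_words m u v s :
  (s \in even_gap_words m u v) = (size s == m) && path even_gap u (rcons s v).
Proof.
elim: m u s => [|m IH] u s /=.
  case: ifP => uv; case: s => [|a s] //=; rewrite /= ?in_cons ?uv //.
apply/allpairsPdep/idP => [[r [t [+ + ->]]]|].
  rewrite mem_index_iota IH /= eqSS => /= rv /andP[-> ->]; rewrite andbT.
  by rewrite /even_gap /=; lia.
case: s => [|a s] //=; rewrite eqSS => /andP[sm /andP[/andP[/= ua aodd] pa]].
have av : (a < v)%N.
  have: path ltn a (rcons s v) by apply: sub_path pa => b c /andP[].
  rewrite (path_sortedE ltn_trans) => /andP[/allP /(_ v) + _].
  by apply; rewrite mem_rcons mem_head.
have aE : a = (u + (a - u)./2.*2.+1)%N by lia.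
exists (a - u)./2, s; rewrite -aE IH mem_index_iota sm pa; split=> //; lia.
Qed.

Lemma even_gap_words_uniq m u v : uniq (even_gap_words m u v).
Proof.
elim: m u => [|m IH] u /=; first by case: ifP.
apply: allpairs_uniq_dep => [||[r s] [r' s'] _ _ /= [rE ->]].
- exact: iota_uniq.
- by move=> r _; apply: IH.
by have -> : r = r' by lia.
Qed.

(** Adjacency in an increasing word expressed by membership alone, which makes it
    comparable with a condition on the underlying set. *)
Lemma path_consecutive (r : rel nat) u t : path ltn u t ->
  reflect (forall a b, a \in u :: t -> b \in t -> (a < b)%N ->
             (forall c, c \in t -> ~~ (a < c < b)%N) -> r a b)
          (path r u t).
Proof.
move=> ut; apply: (iffP idP); elim: t u ut => //= b0 t IH u /andP[ub0 b0t].
  move=> /andP[rub rt] a b.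
  have b0_min c : c \in t -> (b0 < c)%N.
    by move: c; apply/allP; move: b0t; rewrite (path_sortedE ltn_trans) => /andP[].
  rewrite in_cons => /orP[/eqP->|a_t].
    rewrite in_cons => /orP[/eqP-> //|bt] ub /(_ b0 (mem_head _ _)).
    by rewrite ub0 b0_min.
  have ab0 : (b0 <= a)%N.
    by move: a_t; rewrite in_cons => /orP[/eqP-> //|/b0_min /ltnW].
  rewrite in_cons => /orP[/eqP->|bt] ab gap; first by move: ab; rewrite ltnNge ab0.
  by apply: (IH b0) => // c ct; apply: gap; rewrite in_cons ct orbT.
move=> H; have b0_min c : c \in t -> (b0 < c)%N.
  by move: c; apply/allP; move: b0t; rewrite (path_sortedE ltn_trans) => /andP[].
apply/andP; split.
  apply: H; rewrite ?mem_head // => c; rewrite in_cons => /orP[/eqP->|/b0_min].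
    by rewrite ltnn andbF.
  by move=> b0c; apply/negP => /andP[_]; rewrite ltnNge ltnW.
apply: IH => // a b a_t bt ab gap; apply: H => //.
- by rewrite in_cons a_t orbT.
- by rewrite in_cons bt orbT.
move=> c; rewrite in_cons => /orP[/eqP->|]; last exact: gap.
move: a_t; rewrite in_cons => /orP[/eqP->|/b0_min]; first by rewrite ltnn.
by move=> b0a; rewrite ltnNge ltnW.
Qed.

Section EvenGapSets.
Variable l : nat.
Implicit Types (y : 'I_l.+1) (A : {set 'I_l.+1}).

Definition points y (s : seq nat) : {set 'I_l.+1} :=
  [set x in [seq shift y p | p <- 0%N :: s]].

(** The elements of A other than y, as distances from y in cyclic order. *)
Definition window y A : seq nat :=
  [seq p <- index_iota 1 l.+1 | shift y p \in A].

Lemma window_sorted y A : path ltn 0 (rcons (window y A) l.+1).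
Proof.
rewrite -cats1 cat_path /= andbT; apply/andP; split; last first.
  case/lastP E : (window y A) => [|s x] //=; rewrite last_rcons.
  have : x \in window y A by rewrite E mem_rcons mem_head.
  by rewrite mem_filter mem_index_iota => /and3P[].
rewrite (path_sortedE ltn_trans); apply/andP; split.
  by apply/allP => x; rewrite mem_filter mem_index_iota => /and3P[].
by apply: sorted_filter; [exact: ltn_trans | exact: iota_ltn_sorted].
Qed.

Lemma in_points y s : y \in points y s.
Proof. by rewrite inE /= shift0 mem_head. Qed.

Lemma path_rcons_bounds s u v : path ltn u (rcons s v) ->
  [/\ path ltn u s, {in s, forall p, (u < p < v)%N} & (u < v)%N].
Proof.
move=> usv; move: (usv); rewrite -cats1 cat_path => /andP[us _].
move: usv; rewrite (path_sortedE ltn_trans) => /andP[/allP au sv]; split=> //.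
  move=> p ps; rewrite (au p) /= ?mem_rcons ?in_cons ?ps ?orbT //.
  move: sv; rewrite (sorted_pairwise ltn_trans) pairwise_rcons => /andP[/allP sv _].
  exact: sv.
by apply: au; rewrite mem_rcons mem_head.
Qed.

Lemma pointsK y s : path ltn 0 (rcons s l.+1) -> window y (points y s) = s.
Proof.
move=> /path_rcons_bounds[s_path sl _].
have s_sorted : sorted ltn s := path_sorted s_path.
apply: (irr_sorted_eq ltn_trans ltnn) => //.
  by have /path_rcons_bounds[/path_sorted] := window_sorted y (points y s).
move=> p; rewrite mem_filter mem_index_iota inE.
apply/andP/idP => [[/mapP[q qs pq] /andP[p0 pl]]|ps]; last first.
  by split; [apply: map_f; rewrite in_cons ps orbT | apply: sl].
move: qs; rewrite in_cons => /orP[/eqP qE|qs].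
  by move: pq p0; rewrite qE => /shift_inj ->.
by have /andP[_ ql] := sl q qs; rewrite (shift_inj pl ql pq).
Qed.

Lemma windowK y A : y \in A -> points y (window y A) = A.
Proof.
move=> yA; apply/setP => x; rewrite inE; apply/mapP/idP => [[p + ->]|xA].
  by rewrite in_cons mem_filter => /orP[/eqP->|/andP[]//]; rewrite shift0.
have [p pl xE] := shift_surj y x; exists p => //.
case: p pl xE => [|p] pl xE; first exact: mem_head.
by rewrite in_cons mem_filter mem_index_iota -xE xA pl orbT.
Qed.

Lemma card_points y s : path ltn 0 (rcons s l.+1) ->
  #|points y s| = (size s).+1.
Proof.
move=> /path_rcons_bounds[s_path sl _]; rewrite cardsE.
rewrite (card_uniqP _) ?size_map // map_inj_in_uniq.
  have := sorted_uniq ltn_trans ltnn (s := 0%N :: s); exact.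
have s0 p : p \in 0%N :: s -> (p < l.+1)%N.
  by rewrite in_cons => /orP[/eqP->//|/sl /andP[]].
by move=> p q /s0 pl /s0 ql; apply: shift_inj.
Qed.

(** The components of the complement are the nonempty gaps between cyclically
    consecutive elements of A. The end position l + 1 stands for y itself, so
    that the last gap needs no separate treatment. *)
Lemma gap_componentsP y A (c : 'I_l.+1 * 'I_l.+1) : y \in A ->
  reflect (exists u v, [/\ (u.+1 < v <= l.+1)%N, shift y u \in A,
             shift y v \in A, forall w, (u < w < v)%N -> shift y w \notin A &
             c = (shift y u.+1, inord (v - u.+1))])
          (c \in components (~: A)).
Proof.
move=> yA; have CT : ~: A != setT.
  by apply: contraTneq yA => E; have := in_setT y; rewrite -E inE.
apply: (iffP (componentsP _ CT)) => [|[u [v [/andP[uv vl] uA vA gap ->]]]]; last first.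
  have mE : (inord (v - u.+1) : 'I_l.+1) = (v - u.+1)%N :> nat.
    by rewrite inordK //; lia.
  rewrite /= mE; split; first lia.
  - by move=> j jm; rewrite shiftD inE gap //; lia.
  - by rewrite inE negbK shift_pred.
  - by rewrite inE negbK shiftD subnKC // ltnW.
case: c => x m /= [m0 run predA succA].
have [u ul uE] := shift_surj y (shift x l).
have xE : x = shift y u.+1 by rewrite -[u.+1]addn1 -shiftD -uE shiftK.
have runA j : (j < m)%N -> shift y (u.+1 + j) \notin A.
  by move=> /run; rewrite inE xE shiftD.
rewrite !inE !negbK in predA succA.
exists u, (u.+1 + m)%N; rewrite -uE -shiftD -xE; split=> //.
- apply/andP; split; first lia.
  rewrite leqNgt; apply/negP => lm; have := runA (l - u)%N.
  have -> : (u.+1 + (l - u) = l.+1)%N by lia.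
  by rewrite shift_full yA => /(_ _) /implyP; lia.
- move=> w /andP[uw wm]; have -> : w = (u.+1 + (w - u.+1))%N by lia.
  by apply: runA; lia.
- by congr pair; apply: val_inj; rewrite addKn inord_val.
Qed.

Lemma even_gaps_consecutive y A : y \in A ->
  reflect (forall u v, (u < v <= l.+1)%N -> shift y u \in A -> shift y v \in A ->
             (forall w, (u < w < v)%N -> shift y w \notin A) -> odd (v - u))
          [forall c in components (~: A), ~~ odd c.2].
Proof.
move=> yA; apply: (iffP 'forall_implyP).
  move=> H u v /andP[uv vl] uA vA gap.
  case: (leqP v u.+1) => vu; first by have -> : (v - u = 1)%N by lia.
  have := H (shift y u.+1, inord (v - u.+1)); rewrite /= inordK; last by lia.
  move=> odd_uv; suff: ~~ odd (v - u.+1) by lia.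
  by apply/odd_uv/(gap_componentsP _ yA); exists u, v; rewrite vu vl.
move=> H _ /(gap_componentsP _ yA)[u [v [/andP[uv vl] uA vA gap ->]]] /=.
have vuE : (inord (v - u.+1) : 'I_l.+1) = (v - u.+1)%N :> nat.
  by rewrite inordK //; lia.
have: odd (v - u) by apply: H => //; rewrite vl (ltnW uv).
by rewrite vuE; lia.
Qed.

Lemma even_gap_setsE m y A : y \in A ->
  (A \in even_gap_sets l m.+1) = (window y A \in even_gap_words m 0 l.+1).
Proof.
move=> yA; rewrite inE mem_even_gap_words -{1}(windowK yA) card_points ?window_sorted//.
rewrite eqSS; congr andb.
have memA p : (p \in 0%N :: rcons (window y A) l.+1) =
    (p <= l.+1)%N && (shift y p \in A).
  rewrite in_cons mem_rcons in_cons mem_filter mem_index_iota.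
  case: p => [|p]; first by rewrite shift0 yA.
  rewrite eqSS /= ltnS [(p < l.+1)%N]ltnS andbC.
  by case: (ltngtP p l) => //= ->; rewrite shift_full yA.
have memA' p : (0 < p)%N -> (p \in rcons (window y A) l.+1) =
    (p <= l.+1)%N && (shift y p \in A).
  by case: p => // p _; rewrite -memA in_cons.
apply/(even_gaps_consecutive yA)/(path_consecutive _ (window_sorted y A)).
  move=> H a b; rewrite memA => /andP[al aA] bw ab gap; rewrite /even_gap /= ab /=.
  have b0 : (0 < b)%N by apply: leq_ltn_trans ab.
  move: bw; rewrite memA' // => /andP[bl bA].
  apply: H; rewrite ?ab // => w aw; apply/negP => wA.
  by have := gap w; rewrite aw memA' ?wA //; lia.
move=> H u v /andP[uv vl] uA vA gap.
suff /andP[] : even_gap u v by [].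
apply: H => //.
- by rewrite memA uA (ltnW (leq_trans uv vl)).
- by rewrite memA' ?vl ?vA //; lia.
move=> c cA; apply/negP => ucv; have /negP[] := gap c ucv.
by move: cA; rewrite memA' => [/andP[]//|]; lia.
Qed.

(** This turns sums over even gap sets through y into sums over words, on which
    induction is possible. *)
Lemma sum_even_gap_sets (V : nmodType) (F : {set 'I_l.+1} -> V) m y :
  \sum_(A in even_gap_sets l m.+1 | y \in A) F A =
  \sum_(s <- even_gap_words m 0 l.+1) F (points y s).
Proof.
have path_word s : s \in even_gap_words m 0 l.+1 -> path ltn 0 (rcons s l.+1).
  rewrite mem_even_gap_words => /andP[_]; apply: sub_path => a b; by case/andP.
rewrite -(big_map (points y) xpredT F) big_uniq; last first.
  rewrite map_inj_in_uniq ?even_gap_words_uniq // => s t /path_word sP /path_word tP.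
  by move=> /(congr1 (window y)); rewrite !pointsK.
apply: eq_bigl => A; apply/andP/mapP => [[AS yA]|[s sw ->]].
  by exists (window y A); rewrite ?windowK // -even_gap_setsE.
by split; [rewrite (@even_gap_setsE _ y) ?pointsK ?path_word|]; rewrite ?in_points.
Qed.

End EvenGapSets.

(** * Ordered products and their commutators *)

Section Commutator.
Variable K : pzRingType.
Implicit Types a b x : K.

Lemma commutatorDl a b x : commutator (a + b) x = commutator a x + commutator b x.
Proof. by rewrite /commutator mulrDl mulrDr opprD addrACA. Qed.

Lemma commutatorMl a b x :
  commutator (a * b) x = a * commutator b x + commutator a x * b.
Proof. by rewrite /commutator mulrBr mulrBl !mulrA addrA subrK. Qed.

Lemma commutator_suml (I : Type) (r : seq I) (P : pred I) (G : I -> K) x :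
  commutator (\sum_(i <- r | P i) G i) x =
  \sum_(i <- r | P i) commutator (G i) x.
Proof.
apply: (big_morph (fun a => commutator a x)) => [a b|].
  exact: commutatorDl.
by rewrite /commutator mul0r mulr0 subrr.
Qed.

Lemma commutator_eq0 a x : GRing.comm a x -> commutator a x = 0.
Proof. by rewrite /commutator => ->; rewrite subrr. Qed.

Lemma commutator_comm a x : commutator a x = 0 -> GRing.comm a x.
Proof. by move/eqP; rewrite subr_eq0 => /eqP. Qed.

Lemma commutatorN a b : commutator b a = - commutator a b.
Proof. by rewrite /commutator opprB. Qed.

End Commutator.

Section CyclicRelations.
Variables (F : fieldType) (K : unitAlgType F) (l : nat).
Variables (f : 'I_l.+1 -> K) (h : K).
Hypothesis l_ge2 : (2 <= l)%N.
Hypothesis h_comm : forall i, GRing.comm h (f i).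
Hypothesis f_succ : forall i, commutator (f i) (f (shift i 1)) = h.
Hypothesis f_far : forall i j : 'I_l.+1, j != shift i 1 -> i != shift j 1 ->
  commutator (f i) (f j) = 0.

(** The first letter x of s commutes with every letter y that precedes it in t:
    y comes after x in s, so x is not y + 1, and before x in t, so y is not
    x + 1. It can therefore be moved to the front of t. *)
Lemma prod_well_ordered (s t : seq 'I_l.+1) :
  well_ordered s -> well_ordered t -> s =i t ->
  \prod_(x <- s) f x = \prod_(x <- t) f x.
Proof.
have uniq_wo u : well_ordered u -> uniq u.
  by rewrite uniq_pairwise; apply: sub_pairwise => a b /andP[].
elim: s t => [|x s IH] t s_wo t_wo st.
  by case: t st {t_wo} => // y t /(_ y); rewrite mem_head.
have xt : x \in t by rewrite -st mem_head.
have t_uniq := uniq_wo _ _ t_wo; have /= /andP[xs _] := uniq_wo _ _ s_wo.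
case/splitPr: xt st t_wo t_uniq => t1 t2 st t_wo t_uniq.
have t12_wo : well_ordered (t1 ++ t2).
  apply: subseq_pairwise t_wo; apply: cat_subseq; first exact: subseq_refl.
  exact: subseq_cons.
have {}IH := IH (t1 ++ t2) _ t12_wo.
rewrite big_cons IH; first last.
- move=> z; have := st z; rewrite mem_cat !in_cons mem_cat.
  case: (eqVneq z x) => [-> _|_ //].
  move: t_uniq; rewrite uniq_catC /= => /andP[].
  by rewrite mem_cat negb_or (negbTE xs) => /andP[/negbTE -> /negbTE ->].
- by move: s_wo => /= /andP[].
have comm_x : GRing.comm (f x) (\prod_(y <- t1) f y).
  rewrite big_seq; apply: commr_prod => y yt1; apply/commutator_comm.
  move: t_wo; rewrite /well_ordered pairwise_cat => /andP[/allrelP t1x _].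
  have /= /andP[yx yx1] := t1x y x yt1 (mem_head _ _).
  apply: f_far => //.
  have ys : y \in s by have := st y; rewrite mem_cat yt1 !in_cons (negbTE yx).
  by move: s_wo => /= /andP[/allP /(_ y ys) /andP[]].
by rewrite !big_cat big_cons /= !mulrA comm_x.
Qed.

Definition prod_rem (x : 'I_l.+1) (t : seq 'I_l.+1) : K :=
  if x \in t then \prod_(y <- rem x t) f y else 0.

Lemma commutator_f i x : commutator (f x) (f i) =
  h * ((x == shift i l)%:R - (x == shift i 1)%:R).
Proof.
have predE : (x == shift i l) = (i == shift x 1).
  by apply/eqP/eqP => ->; rewrite ?shiftK // shiftD add1n shift_full.
rewrite predE; case: (eqVneq i (shift x 1)) => [iE|ix].
  have -> : (x == shift i 1) = false.
    by rewrite iE shiftD -[X in X == _]shift0 shift_neq //; lia.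
  by rewrite iE f_succ subr0 mulr1.
rewrite sub0r; case: (eqVneq x (shift i 1)) => [->|xi].
  by rewrite commutatorN f_succ mulrN1.
by rewrite f_far // oppr0 mulr0.
Qed.

Lemma commutator_prod i t : uniq t ->
  commutator (\prod_(x <- t) f x) (f i) =
  h * (prod_rem (shift i l) t - prod_rem (shift i 1) t).
Proof.
elim: t => [_|x t IH /= /andP[xt t_uniq]].
  rewrite big_nil /prod_rem !in_nil subr0 mulr0 commutator_eq0 //.
  by apply: commr_sym; apply: commr1.
have rem_cons y : prod_rem y (x :: t) =
    (x == y)%:R * \prod_(z <- t) f z + f x * prod_rem y t.
  rewrite /prod_rem in_cons eq_sym /=; case: eqVneq => [<-|_] /=.
    by rewrite (negbTE xt) mul1r mulr0 addr0.
  by case: ifP; rewrite mul0r add0r ?mulr0 // big_cons.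
rewrite big_cons commutatorMl IH // commutator_f !rem_cons.
rewrite mulrA -h_comm -!mulrA -mulrDr; congr (h * _).
by rewrite mulrBr mulrBl opprD [RHS]addrACA addrC.
Qed.

Lemma f_set_word C : f_set f C = \prod_(x <- component_word C) f x.
Proof.
rewrite /f_set /component_word big_flatten big_map big_filter.
by apply: eq_bigr => p _; rewrite big_map.
Qed.

Definition window_prod (y : 'I_l.+1) (C : {set 'I_l.+1}) : K :=
  if y \in C then \prod_(p <- window y C) f (shift y p) else 0.

(** Deleting i-1 from a well ordered word for C leaves a well ordered word, and
    so does listing C from i-1 on after dropping i-1 itself; both have the same
    letters. The same holds for i+1. *)
Lemma commutator_f_set i C : C != setT ->
  commutator (f_set f C) (f i) =
  h * (window_prod (shift i l) C - window_prod (shift i 1) C).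
Proof.
move=> CT; have word_wo := well_ordered_component_word CT.
have word_uniq : uniq (component_word C).
  by rewrite uniq_pairwise; apply: sub_pairwise word_wo => a b /andP[].
have remE y : prod_rem y (component_word C) = window_prod y C.
  rewrite /prod_rem mem_component_word // /window_prod; case: ifP => // yC.
  have [w_path w_bounds _] := path_rcons_bounds (window_sorted y C).
  rewrite -(big_map (shift y) xpredT f); apply: prod_well_ordered.
  - exact: subseq_pairwise (rem_subseq _ _) word_wo.
  - apply: well_ordered_sorted => //.
    by apply/allP => p /w_bounds /andP[].
  move=> x; rewrite mem_rem_uniq // inE mem_component_word //.
  have [p pl ->] := shift_surj y x; rewrite -[X in (_ != X) && _]shift0 shift_neq //.
  apply/andP/mapP => [[p0 pC]|[q]].
    by exists p => //; rewrite mem_filter pC mem_index_iota pl lt0n p0.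
  rewrite mem_filter mem_index_iota => /and3P[qC q0 ql].
  by move=> /shift_inj ->; rewrite // -lt0n.
by rewrite f_set_word commutator_prod // !remE.
Qed.

Lemma commutator_even_gap_sum i m (c : {set 'I_l.+1} -> K) : (m < l)%N ->
  (forall A, GRing.comm (c A) (f i)) -> (forall A, GRing.comm (c A) h) ->
  let word_sum y := \sum_(s <- even_gap_words m 0 l.+1)
                       c (points y s) * \prod_(p <- s) f (shift y p) in
  commutator (\sum_(A in even_gap_sets l m.+1) c A * f_set f A) (f i) =
  h * (word_sum (shift i l) - word_sum (shift i 1)).
Proof.
move=> ml cf ch word_sum; rewrite commutator_suml.
have sumE y : word_sum y =
    \sum_(A in even_gap_sets l m.+1) c A * window_prod y A.
  rewrite /word_sum.
  transitivity (\sum_(s <- even_gap_words m 0 l.+1)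
      c (points y s) * window_prod y (points y s)).
    apply: eq_big_seq => s sw; rewrite /window_prod in_points pointsK //.
    move: sw; rewrite mem_even_gap_words => /andP[_].
    by apply: sub_path => a b /andP[].
  rewrite -(sum_even_gap_sets (fun A => c A * window_prod y A)) big_mkcondr.
  apply: eq_bigr => A _ /=; rewrite /window_prod.
  by case: (y \in A); rewrite ?mulr0.
rewrite !sumE -sumrB mulr_sumr; apply: eq_bigr => A; rewrite inE => /andP[/eqP Am _].
rewrite commutatorMl (commutator_eq0 (cf A)) mul0r addr0 commutator_f_set.
  by rewrite mulrA ch -mulrA mulrBr.
by apply: contraTneq ml => AT; rewrite -leqNgt -ltnS -Am AT cardsT card_ord.
Qed.

End CyclicRelations.

(** * Telescoping of the word sums *)

Section WordSums.
Variable K : pzRingType.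
Implicit Types g : nat -> K.

Definition word_sum g m u v : K :=
  \sum_(s <- even_gap_words m u v) \prod_(p <- s) g p.

Lemma word_sum0 g u v : word_sum g 0 u v = (even_gap u v)%:R.
Proof.
rewrite /word_sum /=; case: ifP => _; last by rewrite big_nil.
by rewrite big_seq1 big_nil.
Qed.

Lemma word_sumS g m u v : word_sum g m.+1 u v =
  \sum_(0 <= r < (v - u)./2) g (u + r.*2.+1)%N * word_sum g m (u + r.*2.+1) v.
Proof.
rewrite /word_sum /= big_allpairs_dep /=; apply: eq_bigr => r _.
by rewrite mulr_sumr; apply: eq_bigr => s _; rewrite big_cons.
Qed.

Lemma word_sum_shift g m a u v :
  word_sum g m (a + u) (a + v) = word_sum (fun p => g (a + p)%N) m u v.
Proof.
elim: m u => [|m IH] u.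
  by rewrite !word_sum0 /even_gap /= ltn_add2l subnDl.
by rewrite !word_sumS subnDl; apply: eq_bigr => r _; rewrite -addnA IH.
Qed.

(** The first letter is either u + 1, or at least u + 3 by parity. *)
Lemma word_sum_head g m u v : (u.+2 <= v)%N ->
  word_sum g m.+1 u v = g u.+1 * word_sum g m u.+1 v + word_sum g m.+1 u.+2 v.
Proof.
move=> uv; rewrite !word_sumS.
have -> : (v - u)./2 = ((v - u.+2)./2.+1)%N by lia.
rewrite big_nat_recl // addn1; congr (_ + _); apply: eq_bigr => r _.
by rewrite doubleS !addSnnS.
Qed.

Lemma word_sum_geq g m u v : (v <= u)%N -> word_sum g m u v = 0.
Proof.
case: m => [|m] vu; first by rewrite word_sum0 /even_gap /= ltnNge vu.
by rewrite word_sumS (eqP vu) big_geq.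
Qed.

(** The last letter is either v + 1, or at most v - 1 by parity. *)
Lemma word_sum_last g m u v : (u <= v)%N -> odd (v - u) = odd m ->
  word_sum g m.+1 u v.+2 = word_sum g m u v.+1 * g v.+1 + word_sum g m.+1 u v.
Proof.
elim: m u => [|m IH] u uv odd_vu.
  rewrite !word_sumS word_sum0.
  have -> : (v.+2 - u)./2 = ((v - u)./2.+1)%N by lia.
  have uE : (u + (v - u)./2.*2.+1 = v.+1)%N by lia.
  rewrite big_nat_recr //= uE addrC; congr (_ + _).
    rewrite word_sum0 /even_gap /=.
    have -> : (v.+1 < v.+2)%N && odd (v.+2 - v.+1) by lia.
    have -> : (u < v.+1)%N && odd (v.+1 - u) by lia.
    by rewrite mulr1 mul1r.
  apply: eq_big_nat => r /= rv; rewrite !word_sum0 /even_gap /=.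
  by congr (_ * (nat_of_bool _)%:R); lia.
rewrite [LHS]word_sumS.
have -> : (v.+2 - u)./2 = ((v - u)./2.+1)%N by lia.
rewrite (eq_big_nat _ _ (F2 := fun r =>
  g (u + r.*2.+1)%N * (word_sum g m (u + r.*2.+1) v.+1 * g v.+1) +
  g (u + r.*2.+1)%N * word_sum g m.+1 (u + r.*2.+1) v)); last first.
  move=> r rv; rewrite -mulrDr; congr (_ * _).
  case: (leqP (u + r.*2.+1) v) => rv'; first by rewrite IH //; lia.
  (* Here u + 2r + 1 = v + 1, and all three sums are empty. *)
  rewrite (@word_sum_geq _ _ _ v.+1) // (@word_sum_geq _ _ _ v) 1?ltnW //.
  rewrite mul0r addr0.
  by rewrite word_sumS (_ : (_)./2 = 0%N) ?big_geq //; lia.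
rewrite big_split /=; congr (_ + _).
  rewrite word_sumS mulr_suml.
  have [vu|vu] := boolP (odd (v - u)).
    have -> : (v.+1 - u)./2 = ((v - u)./2.+1)%N by lia.
    by apply: eq_bigr => r _; rewrite mulrA.
  have -> : (v.+1 - u)./2 = (v - u)./2 by lia.
  rewrite big_nat_recr //= word_sum_geq; last by lia.
  by rewrite mul0r mulr0 addr0; apply: eq_bigr => r _; rewrite mulrA.
rewrite big_nat_recr //= word_sum_geq ?mulr0 ?addr0 -?word_sumS //; lia.
Qed.

(** The words common to the windows from 0 to N and from 2 to N + 2 are those
    from 2 to N, and they cancel. *)
Lemma word_sum_telescope g m N : (2 <= N)%N -> odd N = odd m ->
  word_sum g m.+1 0 N - word_sum g m.+1 2 N.+2 =
  g 1 * word_sum g m 1 N - word_sum g m 2 N.+1 * g N.+1.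
Proof.
move=> N2 Nm; rewrite word_sum_head // word_sum_last //; last by lia.
by rewrite opprD addrACA subrr addr0.
Qed.

Lemma word_sum1 g n u v : (v - u = n.*2)%N ->
  word_sum g 1 u v = \sum_(0 <= r < n) g (u + r.*2.+1)%N.
Proof.
move=> vu; rewrite word_sumS vu doubleK; apply: eq_big_nat => r /= rn.
rewrite word_sum0 /even_gap /=.
have -> : (u + r.*2.+1 < v)%N && odd (v - (u + r.*2.+1)) by lia.
by rewrite mulr1.
Qed.

Lemma word_sum2 g n u v : (v - u = n.*2.+1)%N ->
  word_sum g 2 u v = \sum_(0 <= r < n) \sum_(r <= s < n)
    g (u + r.*2.+1)%N * g (u + s.*2.+2)%N.
Proof.
move=> vu; rewrite word_sumS vu.
have -> : (n.*2.+1)./2 = n by lia.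
apply: eq_big_nat => r /= rn; rewrite (@word_sum1 _ (n - r)); last by lia.
rewrite mulr_sumr [RHS](big_addn 0 n r); apply: eq_bigr => s _.
by congr (_ * g _); lia.
Qed.

End WordSums.

(** * The weights of the quadratic part *)

Section Weights.
Variables (F : fieldType) (K : unitAlgType F) (l : nat).
Variable alpha : 'I_l.+1 -> K.
Hypothesis charF0 : forall m, m.+1%:R != 0 :> F.

Local Notation w := (varpi alpha).
Local Notation k := (k_sum alpha).

Definition second_difference (x : 'I_l.+1) : K :=
  2%:R * w x - w (shift x 1) - w (shift x l).

(** Up to a linear term in i, the coefficient of alpha_r in varpi_i is min(i, r),
    whose second difference in i is supported at r. The formula for varpi_i also
    vanishes at i = 0 and at i = l + 1, so the index 0 differs only in that i
    jumps by l + 1 there; this produces the term k. *)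
Lemma second_differenceE x :
  second_difference x = alpha x - (x == 0%N :> nat)%:R * k.
Proof.
pose V (i : nat) := \sum_(1 <= r < l.+1)
    ((minn i r)%:R - (i * r)%:R / l.+1%:R : F) *: alpha (inZp r).
have wV (y : 'I_l.+1) : w y = V y.
  rewrite /varpi; case: eqP => // ->; rewrite /V big1 // => r _.
  by rewrite min0n mul0n mul0r subrr scale0r.
have VN : V l.+1 = 0.
  rewrite /V big_nat big1 // => r /andP[_ rl]; rewrite natrM mulrAC divff //.
  by rewrite mul1r (minn_idPr (ltnW rl)) subrr scale0r.
have w_inZp (p : nat) : (p <= l.+1)%N -> w (inZp p) = V p.
  rewrite wV leq_eqVlt => /orP[/eqP->|pl]; last by rewrite /= modn_small.
  by rewrite /= modnn VN -(wV ord0) /varpi eqxx.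
rewrite /second_difference wV /shift addn1 w_inZp ?ltn_ord //.
case: (posnP x) => [x0|x_gt0].
  rewrite x0 add0n w_inZp ?leqnSn // -[V 0%N](wV ord0) {1}/varpi eqxx.
  rewrite mulr0 sub0r mul1r.
  have -> : V 1 = k - alpha ord0 - V l.
    rewrite /k_sum big_ord_recl [_ + _ - alpha _]addrAC subrr add0r.
    rewrite (_ : \sum_(i < l) _ = \sum_(1 <= r < l.+1) alpha (inZp r)); last first.
      rewrite big_add1 big_mkord; apply: eq_bigr => i _; congr alpha.
      by apply: val_inj; rewrite /= modn_small ?ltnS.
    rewrite /V -sumrB; apply: eq_big_nat => r /andP[r0 rl].
    rewrite -[X in _ = X - _]scale1r -scalerBl; congr (_ *: _).
    have N0 := charF0 l; rewrite (minn_idPl r0) (minn_idPr _) //.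
    by move: N0; rewrite !natrM -natr1 => N0; field.
  have -> : x = ord0 by apply: val_inj.
  by rewrite !opprB addrAC subrr add0r.
rewrite mul0r subr0.
have -> : (inZp (x + l) : 'I_l.+1) = inZp x.-1.
  by apply: val_inj; rewrite -[in LHS](prednK x_gt0) /= addSnnS modnDr.
rewrite w_inZp; last by have := ltn_ord x; lia.
rewrite /V mulr_sumr -!sumrB.
rewrite (eq_big_nat _ _ (F2 := fun r => (r == x)%:R *: alpha (inZp r))).
  rewrite (bigD1_seq (x : nat)) ?iota_uniq ?mem_index_iota ?x_gt0 ?ltn_ord //=.
  rewrite eqxx scale1r big1 => [|r /negbTE ->]; last by rewrite scale0r.
  by rewrite addr0; congr alpha; apply: val_inj; rewrite /= modn_small.
move=> r _; rewrite mulr_natl scalerMnl -!scalerBl; congr (_ *: _).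
have N0 := charF0 l.
have minE : 2 * (minn x r)%:R =
    (minn x.+1 r)%:R + (minn x.-1 r)%:R + (r == x)%:R :> F.
  by rewrite -natrM -!natrD; congr (_%:R); lia.
have -> : (r == x)%:R = 2 * (minn x r)%:R - (minn x.+1 r)%:R - (minn x.-1 r)%:R :> F.
  by rewrite minE; ring.
have xE : x%:R = x.-1%:R + 1 :> F by rewrite natr1 prednK.
by move: N0; rewrite mulr2n !natrM -!(natr1 l, natr1 x) xE => N0; field.
Qed.

End Weights.

Section GapWeights.
Variables (F : fieldType) (K : unitAlgType F) (l : nat).
Variables (alpha : 'I_l.+1 -> K).
Local Notation w := (varpi alpha).

Lemma chi_interval0 x : chi_interval alpha x 0 = 0.
Proof. by rewrite /chi_interval big_geq. Qed.

Lemma chi_interval_first x m :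
  chi_interval alpha x m.+1 = w x - chi_interval alpha (shift x 1) m.
Proof.
rewrite /chi_interval big_nat_recl // expr0 mul1r -/(shift x 0) shift0.
congr (_ + _); rewrite -sumrN; apply: eq_bigr => j _.
by rewrite exprS mulN1r mulNr -/(shift x _) -/(shift (shift x 1) _) shiftD.
Qed.

Lemma chi_interval_last x m :
  chi_interval alpha x m.+1 = chi_interval alpha x m + (- 1) ^+ m * w (shift x m).
Proof. by rewrite /chi_interval big_nat_recr. Qed.

(** The two alternating sums agree on the overlap of their intervals, because a
    shift by 2 preserves signs; only the two ends remain. *)
Lemma chi_interval_slide x n :
  chi_interval alpha x n.*2 - chi_interval alpha (shift x 2) n.*2 =
  w x - w (shift x 1) - w (shift x n.*2) + w (shift x n.*2.+1).
Proof.
case: n => [|n].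
  by rewrite /= !chi_interval0 subrr shift0 addrAC subrK subrr.
rewrite doubleS chi_interval_first chi_interval_first shiftD !addn1.
rewrite !(chi_interval_last (shift x 2)) !shiftD exprS -signr_odd odd_double expr0.
rewrite mul1r mulr1 mulN1r opprB [w x + (_ - _)]addrA.
rewrite [w x + chi_interval _ _ _ - _]addrAC.
rewrite -[chi_interval _ _ _ + _ - _]addrA opprD [LHS]addrA addrK opprB.
by rewrite [LHS]addrA addrAC.
Qed.

Lemma chi_one_point y : (0 < l)%N ->
  chi alpha (~: points y [::]) = chi_interval alpha (shift y 1) l.
Proof.
move=> l0; rewrite /chi (_ : components _ = [set (shift y 1, inord l)]).
  by rewrite big_set1 /= inordK.
have memE p : (shift y p \in points y [::]) = (p == 0 %[mod l.+1])%N.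
  by rewrite inE /= inE shift_eq.
apply/setP => c; rewrite in_set1; apply/(gap_componentsP _ (in_points _ _))/eqP.
  move=> [u [v [/andP[uv vl]]]]; rewrite !memE => uA vA _ ->.
  have u0 : u = 0%N by move: uA; rewrite mod0n modn_small; [move/eqP | lia].
  have -> : v = l.+1.
    apply/eqP; rewrite eqn_leq vl leqNgt; apply/negP => vl'.
    by move: vA; rewrite mod0n modn_small //; lia.
  by rewrite u0 subn1.
move=> ->; exists 0%N, l.+1; split; rewrite ?memE ?modnn ?subn1 ?eqxx //.
  by rewrite !ltnS l0 leqnn.
by move=> x /andP[x0 xl]; rewrite memE mod0n modn_small // -lt0n.
Qed.

(** A gap of length 0 is no component, but its alternating sum is empty, so the
    formula covers adjacent points as well. *)
Lemma chi_two_points y b : (0 < b < l.+1)%N ->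
  chi alpha (~: points y [:: b]) =
  chi_interval alpha (shift y 1) b.-1 +
  chi_interval alpha (shift y b.+1) (l - b).
Proof.
move=> /andP[b0 bl].
pose c1 := (shift y 1, inord b.-1) : 'I_l.+1 * 'I_l.+1.
pose c2 := (shift y b.+1, inord (l - b)) : 'I_l.+1 * 'I_l.+1.
have c1E : c1.2 = b.-1 :> nat by rewrite /= inordK //; lia.
have c2E : c2.2 = (l - b)%N :> nat by rewrite /= inordK //; lia.
have c12 : c1 != c2.
  apply/eqP => /(congr1 fst) /= /eqP; rewrite -[b.+1]addn1 addnC -shiftD.
  by rewrite -[X in X == _]shift0 shift_neq //; lia.
have memE p : (p <= l.+1)%N ->
    (shift y p \in points y [:: b]) = [|| p == 0, p == b | p == l.+1]%N.
  rewrite leq_eqVlt => /orP[/eqP->|pl]; first by rewrite shift_full in_points eqxx !orbT.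
  by rewrite inE /= !inE !shift_neq // [p == l.+1]ltn_eqF // orbF.
transitivity (\sum_(c in [set c1; c2]) chi_interval alpha c.1 c.2); last first.
  by rewrite big_setU1 ?inE //= big_set1 c1E c2E.
rewrite /chi [RHS](bigID (fun c : 'I_l.+1 * 'I_l.+1 => (0 < c.2)%N)) /=.
rewrite [X in _ + X]big1 ?addr0; last first.
  by move=> c /andP[_]; rewrite -eqn0Ngt => /eqP ->; rewrite chi_interval0.
apply: eq_bigl => c.
apply/(gap_componentsP _ (in_points _ _))/andP.
  move=> [u [v [/andP[uv vl]]]]; rewrite !memE //; last by lia.
  move=> uA vA gap cE.
  have [[uE vE]|[uE vE]] : (u = 0 /\ v = b)%N \/ (u = b /\ v = l.+1)%N.
  - have ub : ~~ (u < b < v)%N.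
      by apply/negP => /gap; rewrite memE ?eqxx ?orbT // ltnW.
    lia.
  - by rewrite cE uE vE subn1 !inE eqxx; split=> //; rewrite -[inord _]/(c1.2) c1E; lia.
  - by rewrite cE uE vE subSS !inE eqxx orbT; split=> //; rewrite -[inord _]/(c2.2) c2E; lia.
rewrite !inE => -[/orP[/eqP->|/eqP->]].
  rewrite c1E => b1; exists 0%N, b; split; rewrite ?memE ?eqxx ?orbT ?subn1 //; try lia.
  by move=> w wb; rewrite memE; lia.
rewrite c2E => b1; exists b, l.+1; split; rewrite ?memE ?eqxx ?orbT ?subSS //; try lia.
by move=> w wb; rewrite memE; lia.
Qed.

End GapWeights.

(** * Central elements and the cycles of length three and four *)

Section CentralElements.
Variables (F : fieldType) (K : unitAlgType F) (l : nat).
Variables (f alpha : 'I_l.+1 -> K) (h : K).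

Lemma comm_scale (x a : K) (c : F) : GRing.comm x a -> GRing.comm x (c *: a).
Proof. by rewrite /GRing.comm -scalerAr -scalerAl => ->. Qed.

Lemma comm_sign (x : K) m : GRing.comm x ((- 1) ^+ m).
Proof. exact/commrX/commrN/commr1. Qed.

Lemma comm_varpi x i : (forall j, GRing.comm x (alpha j)) ->
  GRing.comm x (varpi alpha i).
Proof.
move=> xa; rewrite /varpi; case: ifP => _; first exact: commr0.
by apply: commr_sum => r _; apply: comm_scale.
Qed.

Lemma comm_chi x C : (forall j, GRing.comm x (alpha j)) ->
  GRing.comm x (chi alpha C).
Proof.
move=> xa; apply: commr_sum => p _; apply: commr_sum => j _.
by apply: commrM; [exact: comm_sign | exact: comm_varpi].
Qed.

Lemma comm_f_set x C : (forall j, GRing.comm x (f j)) -> GRing.comm x (f_set f C).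
Proof. by move=> xf; apply: commr_prod => p _; apply: commr_prod. Qed.

Lemma comm_H0_square x : (forall j, GRing.comm x (alpha j)) ->
  GRing.comm x (H0_square alpha).
Proof.
move=> xa; apply: commrX; apply: commr_sum => i _.
by apply: commrM; [exact: comm_sign | exact: comm_varpi].
Qed.

Lemma comm_H0 x : (forall j, GRing.comm x (f j)) ->
  (forall j, GRing.comm x (alpha j)) -> GRing.comm x h ->
  GRing.comm x (H0 f alpha h).
Proof.
move=> xf xa xh.
have xq d : GRing.comm x (H0_quadratic f alpha d).
  by apply: commr_sum => A _; apply: commrM; [exact: comm_chi | exact: comm_f_set].
have xs d : GRing.comm x (\sum_(A in even_gap_sets l d) f_set f A).
  by apply: commr_sum => A _; apply: comm_f_set.
have x2 := comm_H0_square xa.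
rewrite /H0; case: ifP => _; first by do !apply: commrD => //; do !apply: commrM.
case: ifP => _; first by do !apply: commrD => //; do !apply: commrM.
by case: ifP => _; do !apply: commrD.
Qed.

End CentralElements.

Section SmallCycles.
Variable K : pzRingType.
Variables a b c d h : K.

Lemma commutatorE (x y z : K) : commutator x y = z -> x * y = y * x + z.
Proof. by move=> <-; rewrite /commutator addrC subrK. Qed.

Lemma triangle_rotate : GRing.comm h b ->
  commutator a b = h -> commutator c a = h ->
  b * c * a + h * c = a * b * c + h * b.
Proof.
move=> hb /commutatorE ab /commutatorE ca.
by rewrite -mulrA ca mulrDr mulrA ab mulrDl -hb addrAC.
Qed.

Lemma triangle_commutator : GRing.comm h a -> GRing.comm h b ->
  commutator a b = h -> commutator c a = h ->
  commutator (a * b * c + h * b) a = h * (a * b - c * a).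
Proof.
move=> ha hb ab ca; have aa : commutator a a = 0 by apply: commutator_eq0.
have ba : commutator b a = - h by rewrite commutatorN ab.
rewrite commutatorDl !commutatorMl ca ba aa (commutator_eq0 ha) (commutatorE ca).
rewrite !(mul0r, mulr0, addr0, mulrN, mulNr) !(mulrBr, mulrDr) opprD addrA.
by rewrite -mulrA -hb mulrA -ha -!mulrA.
Qed.

Lemma square_rotate : GRing.comm h b -> GRing.comm h c ->
  commutator a b = h -> commutator d a = h -> GRing.comm a c ->
  b * c * d * a + h * c * d = a * b * c * d + h * b * c.
Proof.
move=> hb hc /commutatorE ab /commutatorE da ac.
rewrite -mulrA da mulrDr mulrA -[b * c * a]mulrA -ac mulrA ab !mulrDl.
by rewrite -[b * c * h]mulrA -hc mulrA -hb addrAC.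
Qed.

Lemma square_commutator : GRing.comm h a -> GRing.comm h b -> GRing.comm h c ->
  commutator a b = h -> commutator d a = h -> GRing.comm a c ->
  commutator (a * b * c * d + h * b * c) a = h * (a * (b * c) - c * d * a).
Proof.
move=> ha hb hc ab da ac; have aa : commutator a a = 0 by apply: commutator_eq0.
have ba : commutator b a = - h by rewrite commutatorN ab.
have ca : commutator c a = 0 by apply/commutator_eq0/commr_sym.
rewrite commutatorDl !commutatorMl da ba aa ca (commutator_eq0 ha).
rewrite !(mul0r, mulr0, addr0, add0r, mulrN, mulNr) -[c * d * a]mulrA (commutatorE da).
rewrite [RHS]mulrBr [c * (_ + _)]mulrDr [c * (a * d)]mulrA -ac mulrDr opprD addrA.
by rewrite -hc !mulrA -[_ * h]mulrA -hc mulrA -[_ * b * h]mulrA -hb mulrA -ha.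
Qed.

End SmallCycles.

(** * The commutators of the Hamiltonian with the generators *)

Section HamiltonianVectorField.
Variables (F : fieldType) (K : unitAlgType F) (l : nat).
Variables (f alpha : 'I_l.+1 -> K) (h : K).
Hypothesis charF0 : forall m, m.+1%:R != 0 :> F.
Hypothesis l_ge2 : (2 <= l)%N.
Hypothesis h_f : forall i, GRing.comm h (f i).
Hypothesis alpha_f : forall j i, GRing.comm (alpha j) (f i).
Hypothesis alpha_h : forall j, GRing.comm (alpha j) h.
Hypothesis f_succ : forall i, commutator (f i) (f (shift i 1)) = h.
Hypothesis f_far : forall i j : 'I_l.+1, j != shift i 1 -> i != shift j 1 ->
  commutator (f i) (f j) = 0.

Local Notation w := (varpi alpha).
Local Notation kappa := (second_difference alpha).

Lemma shift_around (i : 'I_l.+1) p : shift (shift i l) p.+1 = shift i p.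
Proof. by rewrite -(shiftD _ 1 p) shiftK. Qed.

Lemma shift_turn (x : 'I_l.+1) p : p = l.+1 -> shift x p = x.
Proof. by move=> ->; rewrite shift_full. Qed.

(** With positions counted from i-1, the sets through i+1 form the window that is
    shifted by 2, and both 1 and l + 2 are positions of i. *)
Lemma commutator_set_sum i m : (m.+1 < l)%N -> odd l.+1 = odd m ->
  let g p := f (shift (shift i l) p) in
  commutator (\sum_(A in even_gap_sets l m.+2) f_set f A) (f i) =
  h * (f i * word_sum g m 1 l.+1 - word_sum g m 2 l.+2 * f i).
Proof.
move=> ml lm g.
have := @commutator_even_gap_sum _ _ _ _ _ l_ge2 h_f f_succ f_far i _ (fun=> 1) ml
  (fun=> commr_sym (commr1 _)) (fun=> commr_sym (commr1 _)) => /=.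
under eq_bigr do rewrite mul1r; move=> ->; congr (h * _).
have sumE y : \sum_(s <- even_gap_words m.+1 0 l.+1)
     1 * \prod_(p <- s) f (shift y p) =
   word_sum (fun p => f (shift y p)) m.+1 0 l.+1.
  by apply: eq_bigr => s _; rewrite mul1r.
rewrite !sumE.
have -> : word_sum (fun p => f (shift (shift i 1) p)) m.+1 0 l.+1 =
    word_sum g m.+1 2 l.+3.
  rewrite -[2%N]/(2 + 0)%N -[l.+3]/(2 + l.+1)%N word_sum_shift.
  apply: eq_bigr => s _; apply: eq_bigr => p _.
  by rewrite /g add2n shift_around shiftD add1n.
rewrite -/g word_sum_telescope //; last by apply: leq_trans l_ge2 _.
have -> : g l.+2 = f i by rewrite /g shift_around shift_full.
by have -> : g 1%N = f i by rewrite /g shiftK.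
Qed.

Definition triangle (x : 'I_l.+1) : K :=
  f x * f (shift x 1) * f (shift x 2) + h * f (shift x 1).

Definition square (x : 'I_l.+1) : K :=
  f x * f (shift x 1) * f (shift x 2) * f (shift x 3) +
  h * f (shift x 1) * f (shift x 2).

Lemma f_succ_at (x : 'I_l.+1) p q : shift x q = shift x p.+1 ->
  commutator (f (shift x p)) (f (shift x q)) = h.
Proof. by move=> ->; rewrite -addn1 -shiftD f_succ. Qed.

(** The two commutators that arise when f_x is moved from the front to the back
    are h times single generators, and they replace the correction term by the
    rotated one. *)
Lemma triangle_invariant (i x : 'I_l.+1) : l = 2%N -> triangle x = triangle i.
Proof.
move=> l2; have [p _ ->] := shift_surj i x.
have rot z : triangle (shift z 1) = triangle z.
  rewrite /triangle !shiftD /= [shift z 3]shift_turn ?l2 //.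
  apply: triangle_rotate => //.
  rewrite -{2}[z]shift0; apply: f_succ_at.
  by rewrite shift0 shift_turn ?l2.
elim: p => [|p IH]; first by rewrite shift0.
by rewrite -addn1 -shiftD rot.
Qed.

Lemma square_invariant (i x : 'I_l.+1) : l = 3%N -> square x = square i.
Proof.
move=> l3; have [p _ ->] := shift_surj i x.
have rot z : square (shift z 1) = square z.
  rewrite /square !shiftD /= [shift z 4]shift_turn ?l3 //.
  apply: square_rotate => //.
    rewrite -{2}[z]shift0; apply: f_succ_at.
    by rewrite shift0 shift_turn ?l3.
  apply: commutator_comm; apply: f_far.
    by rewrite shift_neq; lia.
  by rewrite shiftD -[X in X != _]shift0 shift_neq; lia.
elim: p => [|p IH]; first by rewrite shift0.
by rewrite -addn1 -shiftD rot.
Qed.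

Definition leading_part : K :=
  if l == 2%N then triangle ord0
  else if l == 3%N then square ord0
  else \sum_(A in even_gap_sets l (if odd l then 4 else 3)) f_set f A.

Lemma commutator_leading_even n i : l = n.*2 ->
  commutator leading_part (f i) =
  h * (f i * (\sum_(0 <= r < n) f (shift i r.*2.+1)) -
       (\sum_(0 <= r < n) f (shift i r.*2.+2)) * f i).
Proof.
move=> ln; have l_even : odd l = false by rewrite ln odd_double.
rewrite /leading_part l_even.
have -> : l == 3%N = false by lia.
case: eqP => [l2|/eqP l2].
  have -> : n = 1%N by lia.
  rewrite !big_nat1 (triangle_invariant i _ l2) triangle_commutator //.
  rewrite -{2}[(i)]shift0; apply: f_succ_at.
  by rewrite shift0 shift_turn ?l2.
rewrite commutator_set_sum; [ | lia | by rewrite /= l_even].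
congr (h * (_ * _ - _ * _)).
  rewrite (@word_sum1 _ _ n); last by rewrite ln subn1.
  by apply: eq_bigr => r _; rewrite add1n shift_around.
rewrite (@word_sum1 _ _ n); last by rewrite ln subn2.
by apply: eq_bigr => r _; rewrite add2n shift_around.
Qed.

Lemma commutator_leading_odd n i : l = n.*2.+1 ->
  commutator leading_part (f i) =
  h * (f i * (\sum_(0 <= r < n) \sum_(r <= s < n)
               f (shift i r.*2.+1) * f (shift i s.*2.+2)) -
       (\sum_(0 <= r < n) \sum_(r <= s < n)
               f (shift i r.*2.+2) * f (shift i s.*2.+3)) * f i).
Proof.
move=> ln; have l_odd : odd l by rewrite ln /= odd_double.
rewrite /leading_part l_odd.
have -> : l == 2%N = false by lia.
case: eqP => [l3|/eqP l3].
  have -> : n = 1%N by lia.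
  rewrite !big_nat1 (square_invariant i _ l3) square_commutator //.
    rewrite -{2}[(i)]shift0; apply: f_succ_at.
    by rewrite shift0 shift_turn ?l3.
  apply: commutator_comm; apply: f_far.
    by rewrite shift_neq; lia.
  by rewrite shiftD -[X in X != _]shift0 shift_neq; lia.
rewrite commutator_set_sum; [ | lia | by rewrite /= l_odd].
congr (h * (_ * _ - _ * _)).
  rewrite (@word_sum2 _ _ n); last by rewrite ln subn1.
  apply: eq_bigr => r _; apply: eq_bigr => s _.
  by rewrite !add1n !shift_around.
rewrite (@word_sum2 _ _ n); last by rewrite ln subn2.
apply: eq_bigr => r _; apply: eq_bigr => s _.
by rewrite !add2n !shift_around.
Qed.

Let chi_f C i : GRing.comm (chi alpha C) (f i).
Proof. by apply/commr_sym/comm_chi => j; apply/commr_sym. Qed.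

Let chi_h C : GRing.comm (chi alpha C) h.
Proof. by apply/commr_sym/comm_chi => j; apply/commr_sym. Qed.

Lemma commutator_quadratic_even n i : l = n.*2 ->
  commutator (H0_quadratic f alpha 1) (f i) = h * kappa i.
Proof.
move=> ln.
rewrite (@commutator_even_gap_sum _ _ _ _ _ l_ge2 h_f f_succ f_far i _
  (fun A => chi alpha (~: A)) (ltnW l_ge2)) //=.
have -> : even_gap 0 l.+1 by rewrite /even_gap /= ln odd_double.
rewrite !big_seq1 !big_nil !mulr1 !chi_one_point ?(ltnW l_ge2) //.
have chi_l x : chi_interval alpha x l = chi_interval alpha x n.*2 by rewrite -ln.
rewrite shiftK shiftD !chi_l chi_interval_slide -ln shift_full.
by congr (h * _); rewrite /second_difference mulr_natl mulr2n addrC !addrA.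
Qed.

Lemma chi_interval_add2 x m : chi_interval alpha x m.*2.+2 =
  chi_interval alpha x m.*2 + w (shift x m.*2) - w (shift x m.*2.+1).
Proof.
rewrite !chi_interval_last exprS -signr_odd odd_double expr0.
by rewrite mulr1 mul1r mulN1r.
Qed.

(** A pair through i-1 and a pair through i+1 with the same second point i+2r+2
    have weights that differ by the second difference at i. The pairs whose
    second point is i remain: their weights differ by an alternating sum of
    steps, which regroups into second differences at the points i+2r+2. *)
Lemma commutator_quadratic_odd n i : l = n.*2.+1 ->
  commutator (H0_quadratic f alpha 2) (f i) =
  h * (kappa i * (\sum_(0 <= r < n) f (shift i r.*2.+2)) -
       (\sum_(0 <= r < n) kappa (shift i r.*2.+2)) * f i).
Proof.
move=> ln.
rewrite (@commutator_even_gap_sum _ _ _ _ _ l_ge2 h_f f_succ f_far i _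
  (fun A => chi alpha (~: A)) l_ge2) //.
congr (h * _).
have sumE y : \sum_(s <- even_gap_words 1 0 l.+1)
     chi alpha (~: points y s) * \prod_(p <- s) f (shift y p) =
   \sum_(0 <= r < n.+1)
     (chi_interval alpha (shift y 1) r.*2 +
      chi_interval alpha (shift y r.*2.+2) (n - r).*2) * f (shift y r.*2.+1).
  rewrite big_allpairs_dep /=; have -> : uphalf l = n.+1 by lia.
  apply: eq_big_nat => r /= rn; rewrite add0n.
  have -> : even_gap r.*2.+1 l.+1 by rewrite /even_gap /=; lia.
  rewrite !big_seq1 chi_two_points; last by lia.
  by congr ((_ + chi_interval _ _ _) * _); lia.
rewrite !sumE big_nat_recl // big_nat_recr //= opprD [X in X + _]addrC addrACA.
have -> : shift (shift i 1) n.*2.+1 = i by rewrite shiftD shift_turn // ln.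
rewrite !shift_around shift0 -mulrBl -sumrB mulr_sumr; congr (_ + _).
  apply: eq_big_nat => r /= rn; rewrite !shift_around !shiftD add1n -mulrBl.
  congr (_ * _); rewrite add1n doubleS.
  have -> : (n - r).*2 = (n - r.+1).*2.+2 by lia.
  rewrite (chi_interval_add2 (shift i _)) 2!chi_interval_first !shiftD.
  have -> : (r.*2.+3 + (n - r.+1).*2 = l)%N by lia.
  have -> : shift i (r.*2.+3 + (n - r.+1).*2.+1) = i by apply: shift_turn; lia.
  rewrite /second_difference mulr_natl mulr2n.
  apply/eqP; rewrite subr_eq opprB !addrA [X in _ == X](ACl (1*3*5*6*(4*7)*(2*8))) /=.
  by rewrite addNr subrr !addr0 [w i + _ - _]addrAC.
rewrite -mulNr; congr (_ * _); rewrite subn0 subnn !chi_interval0 add0r addr0.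
rewrite shiftD add1n double0 -[RHS]sumrN; elim: (n) => [|m IH].
  by rewrite big_geq // double0 !chi_interval0 subrr.
rewrite big_nat_recr //= -IH doubleS !chi_interval_add2 !shiftD.
rewrite /second_difference !shiftD mulr_natl mulr2n !add1n !add2n addn1.
rewrite (addSnnS _.+1 l) shift_period.
by rewrite !opprD !opprK !addrA [LHS](ACl (1*4*3*5*6*2)).
Qed.

End HamiltonianVectorField.

(** * The derivation on the generators *)

Section Relations.
Variables (F : fieldType) (K : unitAlgType F) (l : nat).
Variables (f alpha : 'I_l.+1 -> K) (h : K).
Hypothesis charF0 : forall m, m.+1%:R != 0 :> F.
Hypothesis l_ge2 : (2 <= l)%N.
Hypothesis h_unit : h \is a GRing.unit.
Hypothesis h_f : forall i, GRing.comm h (f i).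
Hypothesis alpha_f : forall j i, GRing.comm (alpha j) (f i).
Hypothesis alpha_h : forall j, GRing.comm (alpha j) h.
Hypothesis alpha_alpha : forall i j, GRing.comm (alpha j) (alpha i).
Hypothesis f_succ : forall i, commutator (f i) (f (shift i 1)) = h.
Hypothesis f_far : forall i j : 'I_l.+1, j != shift i 1 -> i != shift j 1 ->
  commutator (f i) (f j) = 0.
Variable d : {linear K -> K}.
Hypothesis dP : is_partial f alpha h d.

Local Notation k := (k_sum alpha).
Local Notation kappa := (second_difference alpha).

Lemma H0E : H0 f alpha h = leading_part f h +
  (if odd l then H0_quadratic f alpha 2 + H0_square alpha
   else H0_quadratic f alpha 1).
Proof.
have inZp0 : inZp 0 = ord0 :> 'I_l.+1 by apply: val_inj.
rewrite /H0 /leading_part /triangle /square !inZp0.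
case: (eqVneq l 2%N) => [l2|_]; first by rewrite (_ : odd l = false) // l2.
case: (eqVneq l 3%N) => [l3|_]; last by case: (odd l); rewrite ?addrA.
by rewrite (_ : odd l = true) ?addrA // l3.
Qed.

Lemma partial_alpha i : d (alpha i) = 0.
Proof.
case: dP => _ -> _ _; rewrite commutator_eq0 ?mulr0 //.
apply: commr_sym; apply: comm_H0 => [j|j|].
- exact: alpha_f.
- exact: alpha_alpha.
exact: alpha_h.
Qed.

Lemma partial_h : d h = 0.
Proof.
case: dP => _ _ -> _; rewrite commutator_eq0 ?mulr0 //.
by apply/commr_sym/comm_H0 => [j|j|]; [exact: h_f | exact/commr_sym | exact: commr_refl].
Qed.

Lemma partial_f_even n i : l = n.*2 ->
  d (f i) = f i * (\sum_(0 <= r < n) f (shift i r.*2.+1))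
          - (\sum_(0 <= r < n) f (shift i r.*2.+2)) * f i + alpha i.
Proof.
move=> ln; have l_even : odd l = false by rewrite ln odd_double.
case: dP => _ _ _ ->; rewrite H0E l_even /= commutatorDl.
rewrite (commutator_leading_even l_ge2 h_f f_succ f_far i ln).
rewrite (commutator_quadratic_even l_ge2 h_f alpha_f alpha_h f_succ f_far i ln).
by rewrite -mulrDr mulKr // (second_differenceE alpha charF0) addrA subrK.
Qed.

(** The points i+2, i+4, ..., i+2n omit from the even translates of i only i
    itself, so they reach 0 exactly when i is even and nonzero. *)
Lemma sum_return n (i : 'I_l.+1) : l = n.*2.+1 ->
  \sum_(0 <= r < n) (shift i r.*2.+2 == 0%N :> nat)%:R =
  (~~ odd i && (0 < i)%N)%:R :> K.
Proof.
move=> ln; have il : (i < n.*2.+2)%N by have := ltn_ord i; lia.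
(* The sum i + 2r + 2 stays below 2 (l + 1), so l + 1 is its only multiple. *)
have shift_0 r : (r < n)%N ->
    (shift i r.*2.+2 == 0%N :> nat) = (i + r.*2.+2 == n.*2.+2)%N.
  move=> rn; rewrite /= -(_ : l.+1 = n.*2.+2); last by rewrite ln.
  apply/eqP/eqP => [/eqP|->]; last by rewrite modnn.
  rewrite -/(dvdn _ _) => /dvdnP[[|[|q]] qE]; lia.
rewrite (eq_big_nat _ _ (F2 := fun r => (i + r.*2.+2 == n.*2.+2)%N%:R)); last first.
  by move=> r rn; rewrite shift_0.
have [/andP[i_even i0]|i_no] := boolP (~~ odd i && (0 < i)%N).
  rewrite (bigD1_seq (n - i./2)%N) ?iota_uniq ?mem_index_iota //=; last by lia.
  have -> : (i + (n - i./2).*2.+2 == n.*2.+2)%N by lia.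
  by rewrite big1 ?addr0 // => r rE; rewrite (_ : (_ == _) = false) //; lia.
by rewrite big_nat big1 // => r rn; rewrite (_ : (_ == _) = false) //; lia.
Qed.

Lemma x0_sumE n : l = n.*2.+1 ->
  x0_sum f = f ord0 + \sum_(0 <= r < n) f (shift ord0 r.*2.+2).
Proof.
move=> ln.
have sum_even (G : nat -> K) m :
    \sum_(0 <= j < m.*2 | ~~ odd j) G j = \sum_(0 <= r < m) G r.*2.
  elim: m => [|m IH]; first by rewrite !big_geq.
  rewrite doubleS [RHS]big_nat_recr //= -IH [LHS]big_mkcond [in RHS]big_mkcond.
  by rewrite !big_nat_recr //= odd_double /= addr0.
transitivity (\sum_(0 <= j < n.+1.*2 | ~~ odd j) f (inZp j)).
  rewrite doubleS -ln big_mkord; apply: eq_bigr => i _; congr f.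
  by apply: val_inj; rewrite /= modn_small.
rewrite sum_even big_nat_recl //; congr (f _ + _); last first.
  by apply: val_inj.
Qed.

(** The exceptional terms with k at the index 0 enter twice, through the second
    difference at i and through those at i+2r+2. Together with the terms with
    k/2 and x_0 they leave k/2 f_i in each of the cases i = 0, i odd, and i even
    and nonzero. *)
Lemma partial_f_odd n i : l = n.*2.+1 ->
  d (f i) = f i * (\sum_(0 <= r < n) \sum_(r <= s < n)
                     f (shift i r.*2.+1) * f (shift i s.*2.+2))
          - (\sum_(0 <= r < n) \sum_(r <= s < n)
               f (shift i r.*2.+2) * f (shift i s.*2.+3)) * f i
          + (2^-1 *: k - \sum_(0 <= r < n) alpha (shift i r.*2.+2)) * f i
          + alpha i * (\sum_(0 <= r < n) f (shift i r.*2.+2)).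
Proof.
move=> ln; have l_odd : odd l by rewrite ln /= odd_double.
case: dP => _ _ _ ->; rewrite H0E l_odd /= commutatorDl.
rewrite (commutator_leading_odd l_ge2 h_f f_succ f_far i ln) commutatorDl.
rewrite (commutator_quadratic_odd l_ge2 h_f alpha_f alpha_h f_succ f_far i ln).
rewrite [commutator (H0_square _) _]commutator_eq0; last first.
  by apply/commr_sym/comm_H0_square => j; apply/commr_sym.
rewrite addr0 -mulrDr mulKr // -!addrA; congr (_ + (_ + _)).
rewrite (second_differenceE alpha charF0).
under [\sum_(0 <= r < n) kappa _]eq_bigr do
  rewrite (second_differenceE alpha charF0).
rewrite sumrB -mulr_suml sum_return //.
set S := \sum_(0 <= r < n) f _; set T := \sum_(0 <= r < n) alpha _.
have k_half : k = 2^-1 *: k + 2^-1 *: k.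
  by rewrite -scalerDl -[2^-1 + _]mulr2n -[2^-1 *+ 2]mulr_natl mulfV ?scale1r.
have k_f : k * f i = 2^-1 *: k * f i + 2^-1 *: k * f i by rewrite -mulrDl -k_half.
have [i0|i_gt0] := posnP i.
  have iE : i = ord0 by apply: val_inj.
  have -> : x0_sum f = f i + S by rewrite (x0_sumE ln) /S iE.
  rewrite i0 /= expr0 mul0r subr0 !mul1r mulrDr !mulrBl.
  rewrite k_f -[_ + _ + k * S]addrA addKr !addrA [LHS](ACl (4*3*1*(2*5))) /=.
  by rewrite addNr addr0.
rewrite /= !mul0r subr0 addr0 -signr_odd.
have [i_odd|i_even] := boolP (odd i); rewrite /= ?mul0r ?mul1r ?subr0.
  by rewrite expr1 mulN1r mulNr opprK mulrBl [RHS]addrC [- _ + _]addrC.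
by rewrite !mulrBl opprB k_f [RHS]addrC; congr (_ + _); rewrite addrAC addrK.
Qed.

End Relations.

Section RankOne.
Variables (F : fieldType) (K : unitAlgType F) (f0 f1 f2 alpha1 h : K).
Hypothesis charF0 : forall m, m.+1%:R != 0 :> F.
Hypotheses (h_f0 : GRing.comm h f0) (h_f1 : GRing.comm h f1).
Hypotheses (alpha1_f0 : GRing.comm alpha1 f0) (alpha1_f1 : GRing.comm alpha1 f1).
Hypotheses (alpha1_f2 : GRing.comm alpha1 f2) (alpha1_h : GRing.comm alpha1 h).
Hypothesis f10 : commutator f1 f0 = 2 *: (h * f2).
Hypothesis f02 : commutator f0 f2 = h.
Hypothesis f21 : commutator f2 f1 = h.

Lemma comm_H0_1 x : GRing.comm x f0 -> GRing.comm x f1 -> GRing.comm x f2 ->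
  GRing.comm x alpha1 -> GRing.comm x (H0_1 f0 f1 f2 alpha1).
Proof.
move=> x0 x1 x2 xa; apply: commrD; last exact: commrM.
by apply: comm_scale; apply: commrD; apply: commrM.
Qed.

Lemma half_double (x : K) : 2^-1 *: (2 *: x) = x.
Proof. by rewrite scalerA mulVf ?scale1r //; apply: (charF0 1). Qed.

Lemma commutator_H0_1 :
  [/\ commutator (H0_1 f0 f1 f2 alpha1) f0 = h * (f0 * f2 + f2 * f0 - alpha1),
      commutator (H0_1 f0 f1 f2 alpha1) f1 = h * (alpha1 - f1 * f2 - f2 * f1) &
      commutator (H0_1 f0 f1 f2 alpha1) f2 = h * (f1 - f0)].
Proof.
have commZ (c : F) (a x : K) : commutator (c *: a) x = c *: commutator a x.
  by rewrite /commutator scalerBr -scalerAl -scalerAr.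
have xx (x : K) : commutator x x = 0 by apply: commutator_eq0.
have f01 : commutator f0 f1 = - (2 *: (h * f2)) by rewrite commutatorN f10.
have f20 : commutator f2 f0 = - h by rewrite commutatorN f02.
have f12 : commutator f1 f2 = - h by rewrite commutatorN f21.
rewrite /H0_1; split; rewrite commutatorDl commZ commutatorDl !commutatorMl.
- rewrite xx f10 f20 (commutator_eq0 alpha1_f0) !mul0r !addr0 mulr0 add0r.
  rewrite -scalerAr -scalerAl -scalerDr half_double mulrA -h_f0 mulrN alpha1_h.
  by rewrite -!mulrA -mulrDr -mulrBr.
- rewrite xx f01 f21 (commutator_eq0 alpha1_f1) !mul0r mulr0 add0r !addr0 mulNr mulrN.
  rewrite -scalerAr -scalerAl -opprD -scalerDr scalerN half_double addrC alpha1_h.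
  rewrite !mulrA -h_f1 -!mulrA -mulrDr -mulrBr opprD addrA; congr (_ * _).
  by rewrite addrAC.
rewrite xx f02 f12 (commutator_eq0 alpha1_f2) mulr0 mul0r !addr0.
rewrite mulrN mulNr -h_f0 -h_f1 [- _ + _]addrC -mulrBr -[_ + _]mulr2n.
by rewrite -[X in _ *: X]scaler_nat half_double.
Qed.
End RankOne.

(** * The skew fields of the presented algebras *)

Lemma quotient_unit (F : fieldType) (A : algType F) (K : unitAlgType F)
    (iota : {lrmorphism A -> K}) (a : A) :
  is_quotient_skew_field iota -> a != 0 -> iota a \is a GRing.unit.
Proof.
case=> K_skew iota_inj _ _ a0; apply: K_skew.
by apply: contraNneq a0 => E; apply/eqP/iota_inj; rewrite E rmorph0.
Qed.

Lemma rank1_equations (F : fieldType) (K : unitAlgType F)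
    (iota : {lrmorphism ore1 F -> K}) (d : {linear K -> K}) :
  (forall m, m.+1%:R != 0 :> F) ->
  let g x := iota (ore1_gen F x) in
  let f0 := g F10 in let f1 := g F11 in let f2 := g F12 in
  let alpha0 := g Alpha10 in let alpha1 := g Alpha11 in let h := g Hbar1 in
  is_quotient_skew_field iota ->
  is_partial1 f0 f1 f2 alpha0 alpha1 h d ->
  [/\ [/\ d f0 = f0 * f2 + f2 * f0 + alpha0,
          d f1 = - (f1 * f2) - f2 * f1 + alpha1
        & d f2 = f1 - f0],
      d alpha0 = 0, d alpha1 = 0 & d h = 0].
Proof.
move=> charF0 g f0 f1 f2 alpha0 alpha1 h qK [_ [da0 da1 dh] [df0 df1 df2]].
have h_unit : h \is a GRing.unit by apply: quotient_unit (hbar1_neq0 _).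
have hC x : GRing.comm h (g x).
  by apply: commutator_comm; apply: gen_comm; apply: rel1_h.
have a0C x : GRing.comm alpha0 (g x).
  by apply: commutator_comm; apply: gen_comm; apply: rel1_alpha0.
have a1C x : GRing.comm alpha1 (g x).
  by apply: commutator_comm; apply: gen_comm; apply: rel1_alpha1.
have f10 : commutator f1 f0 = 2 *: (h * f2).
  rewrite [LHS](gen_commutator iota (@rel1_f1f0 F)) -rmorphM -linearZ.
  by rewrite !pclassM.
have f02 : commutator f0 f2 = h by apply: (gen_commutator iota (@rel1_f0f2 F)).
have f21 : commutator f2 f1 = h by apply: (gen_commutator iota (@rel1_f2f1 F)).
have [c0 c1 c2] := commutator_H0_1 charF0 (hC _) (hC _) (a1C _) (a1C _) (a1C _)
  (a1C _) f10 f02 f21.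
have central x : GRing.comm x f0 -> GRing.comm x f1 -> GRing.comm x f2 ->
    GRing.comm x alpha1 -> h^-1 * commutator (H0_1 f0 f1 f2 alpha1) x = 0.
  by move=> *; rewrite commutator_eq0 ?mulr0 //; apply/commr_sym/comm_H0_1.
split; last exact: etrans dh (central _ (hC _) (hC _) (hC _) (hC _)); first split.
- by rewrite df0 c0 mulKr // [alpha0 + _]addrC addrA subrK.
- by rewrite df1 c1 mulKr // -!addrA addrC -!addrA.
- by rewrite df2 c2 mulKr.
- exact: etrans da0 (central _ (a0C _) (a0C _) (a0C _) (a0C _)).
- exact: etrans da1 (central _ (a1C _) (a1C _) (a1C _) (a1C _)).
Qed.

Section CyclicPresentation.
Variables (F : fieldType) (l : nat) (K : unitAlgType F).
Variable iota : {lrmorphism orel F l -> K}.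
Hypothesis l_ge2 : (2 <= l)%N.
Hypothesis qK : is_quotient_skew_field iota.
Local Notation f := (fun i => iota (orel_gen F (Fl i))).
Local Notation alpha := (fun i => iota (orel_gen F (Alphal i))).
Local Notation h := (iota (orel_gen F (@Hbarl l))).

Lemma orel_h_unit : h \is a GRing.unit.
Proof. exact: quotient_unit (hbarl_neq0 _ l_ge2). Qed.

Lemma orel_h_central x : GRing.comm h (iota (orel_gen F x)).
Proof. by apply: commutator_comm; apply: gen_comm; apply: rell_h. Qed.

Lemma orel_alpha_central j x : GRing.comm (alpha j) (iota (orel_gen F x)).
Proof. by apply: commutator_comm; apply: gen_comm; apply: rell_alpha. Qed.

Lemma orel_succ i : commutator (f i) (f (shift i 1)) = h.
Proof. by rewrite -shiftS; apply: (gen_commutator iota (rell_succ _ i)). Qed.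

Lemma orel_far i j : j != shift i 1 -> i != shift j 1 ->
  commutator (f i) (f j) = 0.
Proof. by rewrite -!shiftS => ij ji; apply: gen_comm; apply: rell_far. Qed.

End CyclicPresentation.

Theorem theorem1p1 (R : realType) :
  (forall (K : unitAlgType (complex R))
          (iota : {lrmorphism ore1 (complex R) -> K}) (d : {linear K -> K}),
     let g x := iota (ore1_gen (complex R) x) in
     let f0 := g F10 in let f1 := g F11 in let f2 := g F12 in
     let alpha0 := g Alpha10 in let alpha1 := g Alpha11 in let h := g Hbar1 in
     is_quotient_skew_field iota ->
     is_partial1 f0 f1 f2 alpha0 alpha1 h d ->
     [/\ [/\ d f0 = f0 * f2 + f2 * f0 + alpha0,
             d f1 = - (f1 * f2) - f2 * f1 + alpha1
           & d f2 = f1 - f0],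
         d alpha0 = 0, d alpha1 = 0 & d h = 0])
  /\
  (forall (n : nat), (1 <= n)%N -> let l := (2 * n)%N in
   forall (K : unitAlgType (complex R))
          (iota : {lrmorphism orel (complex R) l -> K}) (d : {linear K -> K}),
     let f (i : 'I_l.+1) := iota (orel_gen (complex R) (Fl i)) in
     let alpha (i : 'I_l.+1) := iota (orel_gen (complex R) (Alphal i)) in
     let h := iota (orel_gen (complex R) Hbarl) in
     is_quotient_skew_field iota ->
     is_partial f alpha h d ->
     [/\ forall i : 'I_l.+1,
           d (f i) = f i * (\sum_(1 <= r < n.+1) f (inZp (i + 2 * r - 1)))
                   - (\sum_(1 <= r < n.+1) f (inZp (i + 2 * r))) * f i
                   + alpha i,
         forall i : 'I_l.+1, d (alpha i) = 0 & d h = 0])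
  /\
  (forall (n : nat), (1 <= n)%N -> let l := (2 * n + 1)%N in
   forall (K : unitAlgType (complex R))
          (iota : {lrmorphism orel (complex R) l -> K}) (d : {linear K -> K}),
     let f (i : 'I_l.+1) := iota (orel_gen (complex R) (Fl i)) in
     let alpha (i : 'I_l.+1) := iota (orel_gen (complex R) (Alphal i)) in
     let h := iota (orel_gen (complex R) Hbarl) in
     let k := \sum_(i < l.+1) alpha i in
     is_quotient_skew_field iota ->
     is_partial f alpha h d ->
     [/\ forall i : 'I_l.+1,
           d (f i) =
             f i * (\sum_(1 <= r < n.+1) \sum_(r <= s < n.+1)
                      f (inZp (i + 2 * r - 1)) * f (inZp (i + 2 * s)))
           - (\sum_(1 <= r < n.+1) \sum_(r <= s < n.+1)
                f (inZp (i + 2 * r)) * f (inZp (i + 2 * s + 1))) * f i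
           + (2^-1 *: k - \sum_(1 <= r < n.+1) alpha (inZp (i + 2 * r))) * f i
           + alpha i * (\sum_(1 <= r < n.+1) f (inZp (i + 2 * r))),
         forall i : 'I_l.+1, d (alpha i) = 0 & d h = 0]).
Proof.
have charC m : m.+1%:R != 0 :> complex R by rewrite Num.Theory.pnatr_eq0.
split; first by move=> K iota d; apply: rank1_equations.
have evenE (i r : nat) : (i + 2 * r.+1 = i + r.*2.+2)%N by rewrite -mul2n; lia.
have pred_evenE (i r : nat) : (i + 2 * r.+1 - 1 = i + r.*2.+1)%N by rewrite -mul2n; lia.
have succ_evenE (i r : nat) : (i + 2 * r.+1 + 1 = i + r.*2.+3)%N by rewrite -mul2n; lia.
split=> n n1 l K iota d f alpha h.
  move=> qK dP; have l2 : (2 <= l)%N by rewrite /l; lia.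
  have ln : l = n.*2 by rewrite /l mul2n.
  split=> [i|i|].
  - rewrite (partial_f_even charC l2 (orel_h_unit l2 qK)
      (fun i => orel_h_central iota (Fl i)) (fun j i => orel_alpha_central iota j (Fl i))
      (fun j => orel_alpha_central iota j Hbarl) (orel_succ iota) (@orel_far _ _ _ iota)
      dP i ln).
    rewrite !big_add1 /=; congr (_ * _ - _ * _ + _).
      by apply: eq_bigr => r _; rewrite pred_evenE.
    by apply: eq_bigr => r _; rewrite evenE.
  - apply: (partial_alpha (fun j i => orel_alpha_central iota j (Fl i))
      (fun j => orel_alpha_central iota j Hbarl)
      (fun i j => orel_alpha_central iota j (Alphal i)) dP).
  - exact: (partial_h (fun i => orel_h_central iota (Fl i))
      (fun j => orel_alpha_central iota j Hbarl) dP).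
move=> k qK dP; have l2 : (2 <= l)%N by rewrite /l; lia.
have ln : l = n.*2.+1 by rewrite /l mul2n addn1.
split=> [i|i|].
- rewrite (partial_f_odd charC l2 (orel_h_unit l2 qK)
    (fun i => orel_h_central iota (Fl i)) (fun j i => orel_alpha_central iota j (Fl i))
    (fun j => orel_alpha_central iota j Hbarl) (orel_succ iota) (@orel_far _ _ _ iota)
    dP i ln).
  rewrite !big_add1 /=; congr (_ * _ - _ * _ + (_ - _) * _ + _ * _).
  + apply: eq_bigr => r _; rewrite big_add1; apply: eq_bigr => s _.
    by rewrite pred_evenE evenE.
  + apply: eq_bigr => r _; rewrite big_add1; apply: eq_bigr => s _.
    by rewrite succ_evenE evenE.
  + by apply: eq_bigr => r _; rewrite evenE.
  + by apply: eq_bigr => r _; rewrite evenE.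
- apply: (partial_alpha (fun j i => orel_alpha_central iota j (Fl i))
    (fun j => orel_alpha_central iota j Hbarl)
    (fun i j => orel_alpha_central iota j (Alphal i)) dP).
- exact: (partial_h (fun i => orel_h_central iota (Fl i))
    (fun j => orel_alpha_central iota j Hbarl) dP).
Qed.
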